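(* For every $n$ there is a constant $C(n)$ depending only on $n$ such that the following holds. Let $\Omega\subset\mathbb{C}^n$ be a domain such that $\Omega \subset \subset B_r \subset B_{2r}$ and let $f \in C(\overline{\Omega})$ be non-negative. Let $u \in C(\overline{\Omega})$ be a viscosity supersolution of the equation $M_{\mathbb{C}} (u) = f$ in $\Omega$ with $u \geq 0$ on $\partial \Omega$. Then $$\sup_{\Omega} u^{-} \leq C(n)\, r\, \big\| f \cdot \chi_{\{ u =\Gamma_u\}}\big\|_{L^2(\Omega)}^{1/n}.$$
   Context: $B_r\subset B_{2r}$ are concentric balls in $\mathbb{C}^n\cong\mathbb{R}^{2n}$ of radii $r$ and $2r$. $\chi_S$ denotes the characteristic function of $S$. Convex envelope: for $w$ continuous on $\overline\Omega$ with $\Omega\subset\subset B_r\subset B_{2r}$ and $w\ge 0$ on $\partial\Omega$, let $w^-:=-\inf\{w,0\}$ (pointwise), extended by zero to $B_{2r}$, and $$\Gamma_w(x):=\sup\{v(x): v \text{ convex in } B_{2r},\ v\le -w^- \text{ in } B_{2r}\}.$$ $\{w=\Gamma_w\}$ denotes the contact set $\{x\in\Omega: w(x)=\Gamma_w(x)\}$. For a $C^2$ function $\varphi$, $M_{\mathbb{C}}(\varphi) := \det(2\varphi_{\bar j i})$, where $\varphi_{\bar j i} = \partial^2\varphi/\partial z^i\partial \bar z^j$. $T^+(n)$ is the set of polynomials $p(z) = \sum_{i,j} A_{\bar j i} z^i \bar z^j$ with $A$ a non-negative Hermitian $n\times n$ matrix, so that $M_{\mathbb{C}}(p)=\det(2A)$.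 $H(n)$ is the space of holomorphic polynomials in $z^1,\dots,z^n$ of degree at most $2$. A continuous function $\varphi$ touches $u$ from below at $z_0$ if $\varphi(z_0)=u(z_0)$ and $\varphi\le u$ in some open neighborhood of $z_0$. A continuous plurisubharmonic function $u$ on $\Omega$ is a viscosity supersolution of $M_{\mathbb{C}}(u)=f(z)$ if: for any $p\in T^+(n)$, if there exists $h\in H(n)$ such that $p+\mathrm{Re}(h)$ touches $u$ from below at some $z_0\in\Omega$, then $M_{\mathbb{C}}(p)\le f(z_0)$. *)

(* Defs.v *)
From HB Require Import structures.
From mathcomp Require Import all_boot all_order all_algebra.
From mathcomp Require Import complex.
From mathcomp Require Import all_classical all_reals all_analysis.

Set Implicit Arguments.
Unset Strict Implicit.
Unset Printing Implicit Defensive.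

Import Order.TTheory GRing.Theory Num.Theory.
Import numFieldNormedType.Exports.

Local Open Scope classical_set_scope.
Local Open Scope ring_scope.

(* The product sigma-algebra on R^m, generated by the coordinates (as the
   library does for [n.-tuple T]); since R is second countable it is the Borel
   sigma-algebra. *)
Section rV_measurable.
Variables (R : realType) (m : nat).

Let coord_rV (i : 'I_m) (x : 'rV[R]_m) : measurableTypeR R := x 0 i.

Let rV_set0 : g_sigma_preimage coord_rV set0.
Proof. exact: sigma_algebra0. Qed.

Let rV_setC A : g_sigma_preimage coord_rV A -> g_sigma_preimage coord_rV (~` A).
Proof. exact: sigma_algebraC. Qed.

Let rV_bigcup (F : (set 'rV[R]_m)^nat) :
  (forall i, g_sigma_preimage coord_rV (F i)) ->
  g_sigma_preimage coord_rV (\bigcup_i (F i)).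
Proof. exact: sigma_algebra_bigcup. Qed.

HB.instance Definition _ := @isMeasurable.Build default_measure_display
  'rV[R]_m (g_sigma_preimage coord_rV) rV_set0 rV_setC rV_bigcup.

Lemma measurable_coord_rV (i : 'I_m) :
  measurable_fun [set: 'rV[R]_m] (fun x => x 0 i : measurableTypeR R).
Proof.
move=> _ A mA; rewrite setTI; apply: sub_sigma_algebra => /=.
rewrite -bigcup_seq/=; exists i => /=; first by rewrite mem_index_enum.
by exists A => //; rewrite setTI.
Qed.

Lemma measurable_fun_rVP d (T : measurableType d) (f : T -> 'rV[R]_m) :
  (forall i, measurable_fun [set: T] (fun t => f t 0 i : measurableTypeR R)) ->
  measurable_fun [set: T] f.
Proof.
move=> mf.
suff mS : g_sigma_preimage (fun i => coord_rV i \o f) `<=` measurable.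
  by move=> _ A mA; apply: mS; rewrite g_sigma_preimage_comp; exists A.
apply: smallest_sub; first exact: sigma_algebra_measurable.
rewrite -bigcup_seq; apply: bigcup_sub => i _ A [B mB <-].
exact: mf.
Qed.

End rV_measurable.

Section lebesgue_rV.
Variable R : realType.

Definition cons_rV m (p : measurableTypeR R * 'rV[R]_m) : 'rV[R]_m.+1 :=
  row_mx (p.1 : R)%:M p.2 : 'rV_(1 + m).

Definition uncons_rV m (x : 'rV[R]_m.+1) : measurableTypeR R * 'rV[R]_m :=
  ((x : 'rV_(1 + m)) 0 (lshift m 0), rsubmx (x : 'rV_(1 + m))).

Lemma cons_rVK m : cancel (@cons_rV m) (@uncons_rV m).
Proof.
by move=> [a v]; rewrite /uncons_rV /cons_rV row_mxEl row_mxKr mxE eqxx mulr1n.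
Qed.

Lemma uncons_rVK m : cancel (@uncons_rV m) (@cons_rV m).
Proof.
move=> x; apply/rowP => i.
have [j ->|j ->] := split_ordP (i : 'I_(1 + m)).
  by apply: etrans (row_mxEl _ _ 0 j) _; rewrite mxE !ord1 eqxx mulr1n.
by apply: etrans (row_mxEr _ _ 0 j) _; rewrite mxE.
Qed.

Lemma measurable_cons_rV m : measurable_fun setT (@cons_rV m).
Proof.
apply: measurable_fun_rVP => i.
have [j ->|j ->] := split_ordP (i : 'I_(1 + m)).
  rewrite (_ : (fun _ => _) = fst)//; apply/funext => p.
  by apply: etrans (row_mxEl _ _ 0 j) _; rewrite mxE !ord1 eqxx mulr1n.
rewrite (_ : (fun _ => _) =
  (fun x : 'rV[R]_m => x 0 j : measurableTypeR R) \o snd).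
  exact: measurableT_comp (measurable_coord_rV j) measurable_snd.
by apply/funext => p; exact: (row_mxEr _ _ 0 j).
Qed.

HB.instance Definition _ m :=
  @isMeasurableFun.Build _ _ _ _ (@cons_rV m) (@measurable_cons_rV m).

Lemma measurable_uncons_rV m : measurable_fun setT (@uncons_rV m).
Proof.
apply: measurable_fun_pair; first exact: measurable_coord_rV.
apply: measurable_fun_rVP => i.
rewrite (_ : (fun _ => _) = (fun x : 'rV[R]_m.+1 =>
  x 0 (rshift 1 i) : measurableTypeR R)); first exact: measurable_coord_rV.
by apply/funext => x; rewrite mxE.
Qed.

Section step.
Variables (m : nat) (mu : {sigma_finite_measure set 'rV[R]_m -> \bar R}).

Definition lebesgue_rV_step : set 'rV[R]_m.+1 -> \bar R :=
  pushforward (@lebesgue_measure R \x mu)%E (@cons_rV m).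

Let step0 : lebesgue_rV_step set0 = 0%E.
Proof. exact: measure0. Qed.

Let step_ge0 A : (0 <= lebesgue_rV_step A)%E.
Proof. exact: measure_ge0. Qed.

Let step_sigma_additive : semi_sigma_additive lebesgue_rV_step.
Proof. exact: measure_semi_sigma_additive. Qed.

HB.instance Definition _ := isMeasure.Build _ _ _ lebesgue_rV_step
  step0 step_ge0 step_sigma_additive.

Let step_sigma_finite : sigma_finite setT lebesgue_rV_step.
Proof.
have /sigma_finiteP[F [FT ndF Foo]] := sigma_finiteT (@lebesgue_measure R).
have /sigma_finiteP[G [GT ndG Goo]] := sigma_finiteT mu.
exists (fun i => @uncons_rV m @^-1` (F i `*` G i)).
  rewrite -preimage_bigcup (_ : \bigcup_i _ = setT) ?preimage_setT//.
  apply/seteqP; split=> // -[x y] _.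
  have [i _ Fix] : (\bigcup_i F i) x by rewrite -FT.
  have [j _ Gjy] : (\bigcup_i G i) y by rewrite -GT.
  exists (maxn i j) => //; split => /=.
    by move: x Fix; exact/subsetPset/ndF/leq_maxl.
  by move: y Gjy; exact/subsetPset/ndG/leq_maxr.
move=> i; have [mFi Fioo] := Foo i; have [mGi Gioo] := Goo i; split.
  rewrite -[X in measurable X]setTI; apply: measurable_uncons_rV => //.
  exact: measurableX.
rewrite /lebesgue_rV_step /pushforward -comp_preimage.
rewrite (_ : _ \o _ = id); last by apply/funext => p /=; rewrite cons_rVK.
by rewrite preimage_id product_measure1E// lte_mul_pinfty// ge0_fin_numE.
Qed.

HB.instance Definition _ := Measure_isSigmaFinite.Build _ _ _ lebesgue_rV_step
  step_sigma_finite.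

End step.

Fixpoint lebesgue_rV_rec m : {sigma_finite_measure set 'rV[R]_m -> \bar R} :=
  match m with
  | 0%N => \d_(0 : 'rV[R]_0)
  | m'.+1 => lebesgue_rV_step (lebesgue_rV_rec m')
  end.

(* Lebesgue measure on R^m, as the m-fold product of [lebesgue_measure]:
   R^0 carries the unit point mass and R^(1 + m) is identified with
   R * R^m. *)
Definition lebesgue_rV m : set 'rV[R]_m -> \bar R := lebesgue_rV_rec m.

HB.instance Definition _ m := SigmaFiniteMeasure.on (@lebesgue_rV m).

Definition L2norm m (D : set 'rV[R]_m) (g : 'rV[R]_m -> R) : \bar R :=
  Lnorm (@lebesgue_rV m) 2%:E (fun x => (g x * \1_D x)%:E).

End lebesgue_rV.

Section euclidean.
Variables (R : realType) (m : nat).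
Implicit Types (x c : 'rV[R]_m) (A B Omega : set 'rV[R]_m) (w : 'rV[R]_m -> R).

(* The library norm and [ball] on row vectors are those of the sup norm. *)
Definition enorm x : R := Num.sqrt (\sum_i x 0 i ^+ 2).
Definition eball c (r : R) : set 'rV[R]_m := [set x | enorm (x - c) < r].

Definition domain Omega := [/\ open Omega, connected Omega & Omega !=set0].

Definition compactly_contained A B := compact (closure A) /\ closure A `<=` B.

Definition boundary A : set 'rV[R]_m := closure A `\` interior A.

Definition neg_part w x : R := - Num.min (w x) 0.

Definition neg_part_ext Omega w x : R :=
  if x \in closure Omega then neg_part w x else 0.

Definition convex_envelope Omega c (r : R) w x : R :=
  sup [set v x | v in [set v : 'rV[R]_m -> R |
    @convex_function R 'rV[R]_m (eball c (2 * r)) v /\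
    forall y, eball c (2 * r) y -> v y <= - neg_part_ext Omega w y]].

Definition contact_set Omega c (r : R) w : set 'rV[R]_m :=
  [set x | Omega x /\ w x = convex_envelope Omega c r w x].

End euclidean.

(* A point of C^n is given by its 2n real coordinates
   (Re z^1, ..., Re z^n, Im z^1, ..., Im z^n). *)
Section complex_coordinates.
Variables (R : realType) (n : nat).

Local Open Scope complex_scope.

Definition zcoord (x : 'rV[R]_(n + n)) (k : 'I_n) : R[i] :=
  x 0 (lshift n k) +i* x 0 (rshift n k).

Definition realify (z : 'rV[R[i]]_n) : 'rV[R]_(n + n) :=
  row_mx (map_mx (@complex.Re R) z) (map_mx (@complex.Im R) z).

Section wirtinger.
Implicit Types F : 'rV[R]_(n + n) -> R[i].

Definition cderive (v : 'rV[R]_(n + n)) F (x : 'rV[R]_(n + n)) : R[i] :=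
  'D_v (@complex.Re R \o F) x +i* 'D_v (@complex.Im R \o F) x.

Let dx (k : 'I_n) : 'rV[R]_(n + n) := delta_mx 0 (lshift n k).
Let dy (k : 'I_n) : 'rV[R]_(n + n) := delta_mx 0 (rshift n k).

Definition dz k F x : R[i] :=
  2^-1 * (cderive (dx k) F x - (0 +i* 1) * cderive (dy k) F x).

Definition dzbar k F x : R[i] :=
  2^-1 * (cderive (dx k) F x + (0 +i* 1) * cderive (dy k) F x).

End wirtinger.

(* The matrix is Hermitian for C^2 real-valued phi, so its determinant is real
   and the real part only serves to land in R. *)
Definition MC (phi : 'rV[R]_(n + n) -> R) (x : 'rV[R]_(n + n)) : R :=
  complex.Re (\det (\matrix_(j < n, i < n)
    (2 * dz i (dzbar j (fun y => (phi y)%:C)) x))).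

Definition nonneg_hermitian (A : 'M[R[i]]_n) :=
  A \is hermsymmx /\
  forall v : 'I_n -> R[i], 0 <= \sum_i \sum_j A j i * v i * (v j)^*.

Definition Tplus (p : 'rV[R]_(n + n) -> R) :=
  exists2 A : 'M[R[i]]_n, nonneg_hermitian A &
  forall x, (p x)%:C = \sum_i \sum_j A j i * zcoord x i * (zcoord x j)^*.

Definition holo_poly2 (h : 'rV[R]_(n + n) -> R[i]) :=
  exists (a : R[i]) (b : 'I_n -> R[i]) (q : 'I_n -> 'I_n -> R[i]),
  forall x, h x = a + \sum_i b i * zcoord x i
                    + \sum_i \sum_j q i j * zcoord x i * zcoord x j.

Definition touches_below (phi u : 'rV[R]_(n + n) -> R) (x0 : 'rV[R]_(n + n)) :=
  phi x0 = u x0 /\ \forall x \near x0, phi x <= u x.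

(* Sub-mean value property of v on all circles bounding closed discs in D. *)
Definition submean (D : set R[i]) (v : R[i] -> R) :=
  forall (z0 : R[i]) (rho : R), 0 < rho ->
  [set z | Normc.normc (z - z0) <= rho] `<=` D ->
  ((2 * pi * v z0)%:E <= \int[@lebesgue_measure R]_(t in `[0%R, (2 * pi)%R])
     (v (z0 + rho%:C * (cos t +i* sin t)))%:E)%E.

(* Upper semicontinuous on Omega and subharmonic on every complex line. *)
Definition plurisubharmonic (Omega : set 'rV[R]_(n + n))
    (u : 'rV[R]_(n + n) -> R) :=
  (forall x, Omega x -> forall e, 0 < e ->
     \forall y \near x, Omega y -> u y < u x + e) /\
  forall a b : 'rV[R[i]]_n,
    submean [set zeta | Omega (realify (a + zeta *: b))]
            (fun zeta => u (realify (a + zeta *: b))).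

Definition viscosity_supersolution (Omega : set 'rV[R]_(n + n))
    (f u : 'rV[R]_(n + n) -> R) :=
  [/\ {within Omega, continuous u}, plurisubharmonic Omega u &
    forall p, Tplus p ->
    forall h, holo_poly2 h ->
    forall x0, Omega x0 ->
      touches_below (fun x => p x + complex.Re (h x)) u x0 ->
      MC p x0 <= f x0].

End complex_coordinates.

(* Main.v *)
From HB Require Import structures.
Require Import Defs.
From mathcomp Require Import all_boot all_order all_algebra.
From mathcomp Require Import fingroup perm.
From mathcomp Require Import complex.
From mathcomp Require Import all_classical all_reals all_analysis.
From mathcomp Require Import measurable_realfun.
From mathcomp Require Import lra ring zify.

Set Implicit Arguments.
Unset Strict Implicit.
Unset Printing Implicit Defensive.

Import Order.TTheory GRing.Theory Num.Theory.
Import numFieldNormedType.Exports.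

Local Open Scope classical_set_scope.
Local Open Scope ring_scope.

(* If u(x0) = -M < 0, the convex function G, supremum of the affine functions
   x |-> g(p) + <p, x - c> with |p_i| < a = M/(8mr) and g(p) the largest constant
   keeping them below u (m = 2n), is <= 0 on B_{2r}; hence its contact set K
   with u lies in the contact set of u with its convex envelope, and it is enough
   to bound a^m by C * int_K f^2.

   Every slope p is attained at contact points, but no regularity of G or of the
   normal map is available. One works instead with
   W_h = {(p, x) | G(x) < l_p(x) + h}, l_p the affine function of slope p. Its
   sections are convex, so each is comparable to a parallelepiped spanned by a
   flag of directions adapted to the complex structure; using the squared moduli
   of the corresponding n complex linear forms as test functions in the
   definition of a viscosity supersolution gives
     |W_h(p, .)| f(y) >= c h^n   and   |W_h(., x)| <= C h^n f(y')
   for suitable near-contact points y, y'. Integrating f over W_h in the two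
   orders (Tonelli) yields c |P| <= C int f^2 over a neighbourhood of K, up to the
   slopes p and the points x whose sections are not small as h tends to 0. Those
   exceptional sets have small measure, since a large section forces a large
   second difference of g or of G, and these are concave or convex and
   Lipschitz. *)

(** * Lebesgue measure on row vectors *)

(** Heuristically, where G is quadratic with Hessian H, a section of height h has volume comparable
    to h^n / sqrt (det H), because m = 2n, and the corresponding set of slopes has volume comparable
    to h^n sqrt (det H). Both displayed estimates thus express the one inequality sqrt (det H) <= C
    f: the real determinant is controlled by the square of the complex one. Each estimate costs one
    factor f, which is why f^2 appears, and a^(2n) <= C ||f||^2 then has the homogeneity of the
    claim. The classical route, the Hessian of the envelope at almost every point followed by the
    area formula, needs second order differentiability. Here the only inputs are volumes of convex
    sets and touching from below. The inequality between determinants survives in the flags: for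
    each complex coordinate one keeps the better of two real directions, and the squared modulus of
    the resulting complex determinant is at least the product of all m diagonal entries. A test
    function bounds f at one uncontrolled point only. The sections must therefore have small
    diameter before continuity of f can move that bound to other points, and h small does not ensure
    this by itself. *)

Section measure_rV.
Context {R : realType}.
Local Notation mu m := (@lebesgue_rV R m).
Implicit Types m : nat.

Lemma cons_rV0 m (p : R * 'rV[R]_m) : @cons_rV R m p 0 ord0 = p.1.
Proof.
rewrite /cons_rV (_ : ord0 = lshift m (ord0 : 'I_1)); last exact/val_inj.
by rewrite (@row_mxEl _ 1 1 m) mxE eqxx mulr1n.
Qed.

Lemma cons_rVS m (p : R * 'rV[R]_m) (j : 'I_m) :
  @cons_rV R m p 0 (lift ord0 j) = p.2 0 j.
Proof.
rewrite /cons_rV (_ : lift ord0 j = rshift 1 j); last exact/val_inj.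
by rewrite (@row_mxEr _ 1 1 m).
Qed.

Lemma lebesgue_rVS m (A : set 'rV[R]_m.+1) :
  mu m.+1 A =
  (\int[@lebesgue_measure R]_t mu m [set v | A (@cons_rV R m (t, v))])%E.
Proof.
apply: eq_integral => t _ /=; congr (mu m _).
by apply/seteqP; split=> v; rewrite /= /xsection/= ?inE.
Qed.

Lemma measurable_coord_preimage m (i : 'I_m) (A : set R) :
  measurable A -> measurable [set x : 'rV[R]_m | A (x 0 i)].
Proof.
by move=> mA; rewrite -[X in measurable X]setTI; exact: measurable_coord_rV.
Qed.

Definition box m (A : 'I_m -> set R) : set 'rV[R]_m :=
  [set x | forall i, A i (x 0 i)].

Lemma measurable_box m (A : 'I_m -> set R) :
  (forall i, measurable (A i)) ->
  measurable (box A).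
Proof.
move=> mA.
rewrite [X in measurable X](_ : _ =
    \big[setI/setT]_(i < m) [set x : 'rV[R]_m | A i (x 0 i)]).
  by apply: bigsetI_measurable => i _; exact: measurable_coord_preimage.
rewrite -bigcap_seq; apply/seteqP; split=> x /=.
  by move=> h i _; exact: h.
by move=> h i; apply: (h i); rewrite /= mem_index_enum.
Qed.

Lemma measurable_EFin_indic (A : set R) : measurable A ->
  measurable_fun [set: measurableTypeR R] (fun t => (\1_A t : R)%:E).
Proof. by move=> mA; apply/measurable_EFinP; exact: measurable_indic. Qed.

Lemma lebesgue_rV_box m (A : 'I_m -> set R) :
  (forall i, measurable (A i)) ->
  mu m (box A) =
  (\prod_(i < m) @lebesgue_measure R (A i))%E.
Proof.
elim: m A => [|m IH] A mA.
  rewrite big_ord0 (_ : box A = setT); last first.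
    by apply/seteqP; split=> // x _ [].
  by rewrite [LHS]diracE in_setT.
rewrite lebesgue_rVS big_ord_recl.
pose B := box (fun i : 'I_m => A (lift ord0 i)).
transitivity (\int[@lebesgue_measure R]_t ((\1_(A ord0) t)%:E * mu m B))%E.
  apply: eq_integral => t _; rewrite indicE; have [tA|tA] := boolP (t \in A ord0).
    rewrite mul1e; congr (mu m _); apply/seteqP; split=> v /= h i.
      by have := h (lift ord0 i); rewrite cons_rVS.
    have [->|[j ->]] : i = ord0 \/ exists j, i = lift ord0 j.
      by case: (unliftP ord0 i) => [j ->|->]; [right; exists j|left].
    - by rewrite cons_rV0 /=; exact/set_mem.
    - by rewrite cons_rVS; exact: h.
  rewrite mul0e (_ : mkset _ = set0) ?measure0//.
  apply/seteqP; split=> v //= /(_ ord0); rewrite cons_rV0 /= => tA'.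
  by move: tA; rewrite notin_setE.
rewrite ge0_integralZr//; last exact: measurable_EFin_indic.
rewrite integral_indic ?setIT//; last exact: mA.
by rewrite (IH (fun i => A (lift ord0 i))).
Qed.

(** Boxes form a pi-system generating the sigma-algebra, and the cubes [[-k, k]^m] exhaust the space
    with finite measure. *)
Lemma lebesgue_rV_unique m (nu : {measure set 'rV[R]_m -> \bar R}) :
  (forall A : 'I_m -> set R, (forall i, measurable (A i)) ->
    nu (box A) =
    (\prod_(i < m) @lebesgue_measure R (A i))%E) ->
  forall B, measurable B -> nu B = mu m B.
Proof.
move=> nuE B mB.
pose G : set (set 'rV[R]_m) := [set X | exists2 A : 'I_m -> set R,
  (forall i, measurable (A i)) & X = box A].
pose g (k : nat) : set 'rV[R]_m :=
  box (fun=> `[(- k%:R)%R, k%:R]%classic).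
apply: (@measure_unique _ _ _ G g) => //.
- apply/seteqP; split.
    apply: smallest_sub; first exact: smallest_sigma_algebra.
    rewrite -bigcup_seq; apply: bigcup_sub => i _ _ [A mA <-].
    apply: sub_sigma_algebra; exists (fun j => if j == i then A else setT).
      by move=> j; case: ifP.
    apply/seteqP; split=> x /=.
      by move=> [_ Ax] j; case: eqP => // ->.
    by move/(_ i); rewrite eqxx.
  apply: smallest_sub; first exact: sigma_algebra_measurable.
  by move=> _ [A mA ->]; exact: measurable_box.
- move=> _ _ [A mA ->] [A' mA' ->]; exists (fun i => A i `&` A' i).
    by move=> i; exact: measurableI.
  apply/seteqP; split=> x /=.
    by move=> [h h'] i; split; [exact: h|exact: h'].
  by move=> h; split=> i; have [] := h i.
- by move=> i; exists (fun=> `[(- i%:R)%R, i%:R]%classic).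
- apply/seteqP; split=> // x _.
  have [k kx] : exists k : nat, forall i, `|x 0 i| <= k%:R.
    pose F i := (Num.truncn `|x 0 i|).+1.
    exists (\max_(i < m) F i) => i.
    rewrite ltW// (lt_le_trans (truncnS_gt _))// ler_nat.
    exact: (@leq_bigmax _ F i).
  by exists k => // i; rewrite /= in_itv/= -ler_norml.
- by move=> _ [A mA ->]; exact: etrans (nuE _ mA) (esym (lebesgue_rV_box mA)).
- move=> k; rewrite [ltLHS]nuE//.
  rewrite (eq_bigr (fun=> (k%:R + k%:R : R)%:E)); last first.
    move=> i _; rewrite lebesgue_measure_itv/= lte_fin; case: ltP => h.
      by rewrite -EFinD opprK.
    by congr EFin; have : 0 <= k%:R :> R by []; move: h; lra.
  by rewrite -(big_morph _ EFinM (erefl 1%:E)) ltry.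
Qed.

End measure_rV.

(** * Invariance of Lebesgue measure and measurability of open sets *)

Section transfer_rV.
Context {R : realType}.
Local Notation mu m := (@lebesgue_rV R m).
Implicit Types m : nat.

Lemma lebesgue_rV_preimage m (f : 'rV[R]_m -> 'rV[R]_m) :
  measurable_fun setT f ->
  (forall A : 'I_m -> set R, (forall i, measurable (A i)) ->
    mu m (f @^-1` box A) = (\prod_(i < m) @lebesgue_measure R (A i))%E) ->
  forall B, measurable B -> mu m (f @^-1` B) = mu m B.
Proof.
move=> mf fE.
pose mfun_f := isMeasurableFun.Build _ _ _ _ f mf.
pose F : {mfun _ >-> _} := HB.pack f mfun_f.
exact: (@lebesgue_rV_unique R m (pushforward (mu m) F)).
Qed.

Lemma lebesgue_measureD (c : R) (A : set R) : measurable A ->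
  @lebesgue_measure R [set t | A (t + c)] = @lebesgue_measure R A.
Proof.
move=> mA.
transitivity (pushforward (@lebesgue_measure R)
    ((fun t => t + c) : _ -> measurableTypeR R) A) => //.
apply/esym/lebesgue_measure_unique => //=; first exact: measurable_funD.
move=> _ _ [[a b]] _ <-.
rewrite /pushforward.
rewrite (_ : _ @^-1` _ = [set` `]a - c, b - c]]); last first.
  by apply/seteqP; split=> t; rewrite /= !in_itv/= ltrBlDr lerBrDr.
rewrite !lebesgue_measure_itv/= !lte_fin ltrD2r -!EFinD.
by case: ifP => // _; congr EFin; ring.
Qed.

Lemma lebesgue_rV_translation m (v : 'rV[R]_m) (B : set 'rV[R]_m) :
  measurable B -> mu m [set x | B (x + v)] = mu m B.
Proof.
apply: (lebesgue_rV_preimage (f := fun x => x + v)).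
  apply: measurable_fun_rVP => i.
  under eq_fun do rewrite mxE.
  by apply: measurable_funD => //; exact: measurable_coord_rV.
move=> A mA; rewrite (_ : _ @^-1` _ = box (fun i => [set t | A i (t + v 0 i)])).
  rewrite lebesgue_rV_box; first by apply: eq_bigr => i _; exact: lebesgue_measureD.
  move=> i; rewrite -[X in measurable X]setTI.
  exact: measurable_funD.
by apply/seteqP; split=> x /= h i; have := h i; rewrite mxE.
Qed.

Lemma lebesgue_rV_perm m (s : 'S_m) (B : set 'rV[R]_m) :
  measurable B -> mu m [set x | B (col_perm s x)] = mu m B.
Proof.
apply: (lebesgue_rV_preimage (f := col_perm s)).
  apply: measurable_fun_rVP => i.
  under eq_fun do rewrite mxE.
  exact: measurable_coord_rV.
move=> A mA; rewrite (_ : _ @^-1` _ = box (fun i => A ((s^-1)%g i))).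
  rewrite lebesgue_rV_box//.
  by rewrite (reindex_inj (@perm_inj _ s)); apply: eq_bigr => i _; rewrite permK.
apply/seteqP; split=> x /= h i; first by have := h ((s^-1)%g i); rewrite mxE permKV.
by have := h (s i); rewrite mxE permK.
Qed.

(** The sigma-algebra comes from the coordinates, not from the topology. There are countably many
    rational boxes inside A, and they cover it: around a point with a ball of radius e in A, a box
    of radius less than e / 2 suffices. *)
Lemma open_measurable_rV m (A : set 'rV[R]_m) : open A -> measurable A.
Proof.
move=> oA.
pose B (q : 'rV[rat]_m * nat) : set 'rV[R]_m :=
  box (fun i => [set t | `|ratr (q.1 0 i) - t| < q.2.+1%:R^-1]).
have mB q : measurable (B q).
  apply: measurable_box => i; apply: open_measurable.
  rewrite (_ : mkset _ = ball (ratr (q.1 0 i) : R) q.2.+1%:R^-1).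
    exact: ball_open.
  by [].
rewrite (_ : A = \bigcup_q (if `[<B q `<=` A>] then B q else set0)).
  apply: countable_bigcupT_measurable; first exact: countableP.
  by move=> q; case: ifP.
apply/seteqP; split=> x; last first.
  by move=> [q _]; case: ifPn => // /asboolP; exact.
move=> Ax; have /nbhs_ballP[e /= e0 xA] : nbhs x A by exact: open_nbhs_nbhs.
have [k k0 ke] : exists2 k : nat, (0 : R) < k.+1%:R^-1 & 2 * (k.+1%:R^-1) < e.
  exists (Num.truncn (2 / e)); first by rewrite invr_gt0.
  by rewrite ltr_pdivrMr// mulrC -ltr_pdivrMr// truncnS_gt.
have /choice[q qx] : forall i : 'I_m, exists q : rat, `|ratr q - x 0 i| < k.+1%:R^-1.
  move=> i; have : x 0 i - k.+1%:R^-1 < x 0 i + k.+1%:R^-1 by rewrite ltrD2l gt0_cp.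
  move=> /rat_in_itvoo[q]; rewrite in_itv/= => /andP[h1 h2]; exists q.
  by rewrite ltr_norml; set K := k.+1%:R^-1 in h1 h2 *;
    set Q := ratr q in h1 h2 *; apply/andP; split; lra.
exists ((\row_i q i), k) => //.
have -> : `[<B (\row_i q i, k) `<=` A>]; last by move=> i /=; rewrite mxE.
apply/asboolP => y By; apply: xA; split => // i j; rewrite ord1.
have := By j; rewrite /= mxE => h.
rewrite /ball/= (le_lt_trans (ler_distD (ratr (q j)) _ _))//.
by rewrite (lt_trans _ ke)// mulr_natl mulr2n ltrD// distrC.
Qed.

End transfer_rV.

(** * Volume of triangular parallelepipeds *)

Section parallelepiped.
Context {R : realType}.
Local Notation mu m := (@lebesgue_rV R m).
Implicit Types m : nat.

(** For triangular V the first coordinate of x V involves the first coordinate of x alone; once that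
    is fixed, the other conditions have the same form in one dimension less, with a shifted centre.
    Slicing thus replaces the change of variables formula for linear maps. *)
Lemma lebesgue_rV_parallelepiped m (V : 'M[R]_m) (b : 'rV[R]_m) (a : R) :
  0 <= a -> (forall i j : 'I_m, (j < i)%N -> V i j = 0) ->
  (forall i, 0 < V i i) ->
  mu m [set x | forall k, `|(x *m V) 0 k - b 0 k| <= a] =
  (\prod_k (2 * a / V k k))%:E.
Proof.
move=> a0; elim: m V b => [|m IH] V b triV V0.
  rewrite big_ord0 (_ : mkset _ = setT); last first.
    by apply/seteqP; split=> // x _ [].
  by rewrite [LHS]diracE in_setT.
rewrite lebesgue_rVS big_ord_recl.
pose V' : 'M[R]_m := \matrix_(i, j) V (lift ord0 i) (lift ord0 j).
have c0 t (v : 'rV[R]_m) : (@cons_rV R m (t, v) *m V) 0 ord0 = t * V ord0 ord0.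
  rewrite mxE big_ord_recl cons_rV0 big1 ?addr0// => i _.
  by rewrite (triV (lift ord0 i) ord0) ?mulr0.
have cS t (v : 'rV[R]_m) j : (@cons_rV R m (t, v) *m V) 0 (lift ord0 j) =
    t * V ord0 (lift ord0 j) + (v *m V') 0 j.
  rewrite mxE big_ord_recl cons_rV0 mxE; congr (_ + _).
  by apply: eq_bigr => i _; rewrite cons_rVS mxE.
pose I := `[(b 0 ord0 - a) / V ord0 ord0, (b 0 ord0 + a) / V ord0 ord0]%classic.
have IE t : I t = (`|t * V ord0 ord0 - b 0 ord0| <= a).
  rewrite /I /= in_itv/= ler_pdivrMr// ler_pdivlMr// ler_norml.
  by apply/propext; split=> /andP[? ?]; apply/andP; split; lra.
have mI : measurable I by exact: measurable_itv.
pose c : R := \prod_(k < m) (2 * a / V (lift ord0 k) (lift ord0 k)).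
have c_ge0 : 0 <= c.
  by apply: prodr_ge0 => k _; rewrite divr_ge0// ?mulr_ge0// ltW.
transitivity (\int[@lebesgue_measure R]_t ((\1_I t)%:E * c%:E))%E.
  apply: eq_integral => t _; rewrite indicE; have [tI|tI] := boolP (t \in I).
    rewrite mul1e.
    pose b' : 'rV[R]_m := \row_j (b 0 (lift ord0 j) - t * V ord0 (lift ord0 j)).
    transitivity (mu m [set v | forall k, `|(v *m V') 0 k - b' 0 k| <= a]).
      congr (mu m _); apply/seteqP; split=> v /= h.
        move=> k; have := h (lift ord0 k); rewrite cS !mxE => h'.
        by move: h'; congr (`|_| <= _); ring.
      move=> i; have [j ->|->] := unliftP ord0 i.
        by have := h j; rewrite cS !mxE; congr (`|_| <= _); ring.
      by move: tI; rewrite inE IE c0.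
    rewrite IH.
    - by congr EFin; apply: eq_bigr => k _; rewrite mxE.
    - by move=> i j ij; rewrite mxE triV.
    - by move=> i; rewrite mxE.
  rewrite mul0e (_ : mkset _ = set0) ?measure0//.
  apply/seteqP; split=> v //= /(_ ord0); rewrite c0 => tI'.
  by move: tI; rewrite notin_setE IE.
rewrite ge0_integralZr//; last exact: (measurable_EFin_indic mI).
rewrite integral_indic ?setIT//.
rewrite [X in (X * _)%E](_ : _ = (2 * a / V ord0 ord0)%:E) -?EFinM//.
rewrite /= lebesgue_measure_itv/= lte_fin.
have := V0 ord0; set v := V ord0 ord0 => v0.
case: ltP => h.
  by rewrite -EFinD; congr EFin; field; rewrite gt_eqF.
move: h; rewrite ler_pM2r ?invr_gt0// => h.
have -> : a = 0 by lra.
by rewrite mulr0 mul0r.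
Qed.

End parallelepiped.

(** * Parallelepipeds adapted to a convex set *)

Section triangular.
Context {F : fieldType}.

Definition upper_triangular m (U : 'M[F]_m) :=
  forall i j : 'I_m, (j < i)%N -> U i j = 0.

Lemma det_upper_triangular m (U : 'M[F]_m) :
  upper_triangular U -> \det U = \prod_i U i i.
Proof.
move=> triU; rewrite -det_tr det_trig.
  by apply: eq_bigr => i _; rewrite mxE.
by apply/is_trig_mxP => i j ij; rewrite mxE triU.
Qed.

Lemma upper_triangular_unit m (U : 'M[F]_m) :
  upper_triangular U -> (forall i, U i i != 0) -> U \in unitmx.
Proof.
move=> triU U0; rewrite unitmxE det_upper_triangular// unitfE.
by apply/prodf_neq0 => i _; exact: U0.
Qed.

(** Entry (i, l) of V U = 1 with l < i reduces to V_il U_ll = 0 once the earlier columns are known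
    to vanish there; hence the strong induction on the column. *)
Lemma invmx_upper_triangular m (U : 'M[F]_m) :
  upper_triangular U -> (forall i, U i i != 0) ->
  upper_triangular (invmx U) /\ forall i, invmx U i i = (U i i)^-1.
Proof.
move=> triU U0; have Uu := upper_triangular_unit triU U0.
set V := invmx U.
have VU i l : \sum_k V i k * U k l = (i == l)%:R.
  by have /matrixP/(_ i l) := mulVmx Uu; rewrite !mxE.
have triV : upper_triangular V.
  move=> i l; move: {2}l.+1 (ltnSn l) => b; elim: b l => // b IH l lb li.
  have := VU i l; rewrite (bigD1 l)//= big1 ?addr0 => [|k kl].
    move/eqP; rewrite (gtn_eqF _ : (i == l) = false) ?mulf_eq0//.
    by rewrite (negbTE (U0 l)) orbF => /eqP.
  have [lk|kl'] := ltnP l k; first by rewrite triU ?mulr0.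
  have {}kl : (k < l)%N by rewrite ltn_neqAle kl'; apply/andP; split.
  by rewrite IH ?mul0r//; [exact: leq_trans kl lb|exact: ltn_trans kl li].
split => // i.
have := VU i i; rewrite (bigD1 i)//= big1 ?addr0 ?eqxx => [h|k ki].
  by apply: (mulIf (U0 i)); rewrite h mulVf.
have [ik|ki'] := ltnP i k; first by rewrite triU ?mulr0.
by rewrite triV ?mul0r// ltn_neqAle ki' andbT.
Qed.

End triangular.

Section convex_parallelepiped.
Context {R : realType}.
Local Notation mu m := (@lebesgue_rV R m).
Implicit Types m : nat.

Definition convex_rV m (S : set 'rV[R]_m) :=
  forall x y (s t : R), S x -> S y -> 0 <= s -> 0 <= t -> s + t = 1 ->
  S (s *: x + t *: y).

(* The cone generated by {1} * S, so that convex combinations become sums. *)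
Definition cone_over m (S : set 'rV[R]_m) (s : R) (x : 'rV[R]_m) :=
  (s = 0 /\ x = 0) \/ (0 < s /\ S (s^-1 *: x)).

Section cone.
Context m (S : set 'rV[R]_m) (convS : convex_rV S).

Lemma cone_over0 : cone_over S 0 0. Proof. by left. Qed.

Lemma cone_overZ s x : 0 <= s -> S x -> cone_over S s (s *: x).
Proof.
rewrite le_eqVlt => /orP[/eqP<-|s0] Sx; first by left; rewrite scale0r.
by right; split => //; rewrite scalerA mulVf ?gt_eqF// scale1r.
Qed.

Lemma cone_overD s x t y :
  cone_over S s x -> cone_over S t y -> cone_over S (s + t) (x + y).
Proof.
move=> [[-> ->]|[s0 Sx]]; first by rewrite !add0r.
move=> [[-> ->]|[t0 Sy]]; first by rewrite !addr0; right.
have st0 : 0 < s + t by rewrite addr_gt0.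
right; split=> //.
have := convS Sx Sy (_ : 0 <= s / (s + t)) (_ : 0 <= t / (s + t)).
rewrite !divr_ge0 ?(ltW s0) ?(ltW t0) ?(ltW st0)// -mulrDl divff ?gt_eqF//.
move/(_ isT isT erefl); rewrite !scalerA scalerDr.
have E u : 0 < u -> u / (s + t) * u^-1 = (s + t)^-1.
  by move=> u0; rewrite mulrAC divff ?gt_eqF// mul1r.
by rewrite !E.
Qed.

Lemma cone_over1 x : cone_over S 1 x -> S x.
Proof. by move=> [[/eqP]|[_]]; rewrite ?oner_eq0// invr1 scale1r. Qed.

Lemma cone_over_gt0 s x : 0 < s -> cone_over S s x -> S (s^-1 *: x).
Proof. by move=> s0 [[s_eq0]|[]//]; move: s0; rewrite s_eq0 ltxx. Qed.

Lemma cone_over_sum (I : finType) (s : I -> R) (x : I -> 'rV[R]_m) :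
  (forall i, cone_over S (s i) (x i)) ->
  cone_over S (\sum_i s i) (\sum_i x i).
Proof.
move=> h; apply: (big_ind2 (cone_over S)) => //; first exact: cone_over0.
by move=> *; exact: cone_overD.
Qed.

End cone.

Lemma coord_le_norm m (x : 'rV[R]_m) k : `|x 0 k| <= `|x|.
Proof.
rewrite [leRHS]/Num.norm/= mx_normrE.
exact: (le_bigmax _ (fun ij => `|x ij.1 ij.2|) (0, k)).
Qed.

(** The pair nearly maximises the difference of the k-th coordinates among pairs of points of S that
    agree in all earlier ones. The supremum is finite by boundedness but need not be attained, S
    being open, hence the factor 2. *)
Lemma flag_width m (S : set 'rV[R]_m) (B : R) (k : 'I_m) :
  open S -> S !=set0 -> (forall x, S x -> `|x| <= B) ->
  exists ab : 'rV[R]_m * 'rV[R]_m, [/\ S ab.1, S ab.2,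
    forall i : 'I_m, (i < k)%N -> ab.1 0 i = ab.2 0 i, 0 < ab.1 0 k - ab.2 0 k &
    forall x y, S x -> S y -> (forall i : 'I_m, (i < k)%N -> x 0 i = y 0 i) ->
      `|x 0 k - y 0 k| <= 2 * (ab.1 0 k - ab.2 0 k)].
Proof.
move=> oS [s Ss] bS.
pose W := [set w | exists ab : 'rV[R]_m * 'rV[R]_m, [/\ S ab.1, S ab.2,
    forall i : 'I_m, (i < k)%N -> ab.1 0 i = ab.2 0 i & w = ab.1 0 k - ab.2 0 k]].
have coordB x : S x -> `|x 0 k| <= B.
  by move=> /bS; apply: le_trans; exact: coord_le_norm.
have ubW : ubound W (2 * B).
  move=> _ [[a b] [/= /coordB Sa /coordB Sb _ ->]].
  by move: Sa Sb; rewrite !ler_norml => /andP[_ ?] /andP[? _]; lra.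
have [e e0 We] : exists2 e, 0 < e & W e.
  have /nbhs_ballP[e /= e0 sS] : nbhs s S by exact: open_nbhs_nbhs.
  exists (e / 2); first by rewrite divr_gt0.
  exists (s + (e / 2) *: delta_mx 0 k, s) => /=; split=> //.
  - apply: sS; split => // i j; rewrite /ball/= !mxE opprD addrA subrr sub0r.
    rewrite normrN normrM gtr0_norm ?divr_gt0//.
    by case: (_ && _); rewrite ?normr1 ?normr0; lra.
  - by move=> i ik; rewrite !mxE [i == k]ltn_eqF// andbF mulr0 addr0.
  - by rewrite !mxE !eqxx mulr1; ring.
have hsW : has_sup W by split; [exists e|exists (2 * B)].
have s0 : 0 < sup W by apply: lt_le_trans e0 _; exact: sup_upper_bound.
have [_ [[a b] [/= Sa Sb abk ->]] h] := sup_adherent (divr_gt0 s0 (ltr0n R 2)) hsW.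
exists (a, b) => /=; split=> //.
  by move: h s0; lra.
move=> x y Sx Sy xy.
have h1 : x 0 k - y 0 k <= sup W by apply: sup_upper_bound => //; exists (x, y).
have h2 : y 0 k - x 0 k <= sup W.
  by apply: sup_upper_bound => //; exists (y, x); split=> //= i /xy.
by rewrite ler_norml; move: h h1 h2; set w := sup W; move=> *; apply/andP; split; lra.
Qed.

(** Row k of U joins a nearly extremal pair of [flag_width], so U is triangular. The centre z is the
    mean of all the chosen points, each of weight c, and z + t U only redistributes the weights
    within each pair. A triangular frame is preferred to an extremal ellipsoid because its
    determinant is a product of diagonal entries and can be compared with a complex one. *)
Lemma convex_parallelepiped m (S : set 'rV[R]_m.+1) (B : R) :
  open S -> S !=set0 -> (forall x, S x -> `|x| <= B) -> convex_rV S ->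
  exists z (U : 'M[R]_m.+1), [/\ upper_triangular U, forall k, 0 < U k k,
    forall t : 'rV_m.+1, (forall k, `|t 0 k| <= (2 * m.+1%:R)^-1) -> S (z + t *m U) &
    forall x, S x -> forall k, `|((x - z) *m invmx U) 0 k| <= 2 * 3 ^+ m.+1].
Proof.
move=> oS S0 bS convS.
have /choice[ab abP] : forall k : 'I_m.+1, exists ab : 'rV[R]_m.+1 * 'rV[R]_m.+1,
    [/\ S ab.1, S ab.2,
    forall i : 'I_m.+1, (i < k)%N -> ab.1 0 i = ab.2 0 i, 0 < ab.1 0 k - ab.2 0 k &
    forall x y, S x -> S y -> (forall i : 'I_m.+1, (i < k)%N -> x 0 i = y 0 i) ->
      `|x 0 k - y 0 k| <= 2 * (ab.1 0 k - ab.2 0 k)].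
  by move=> k; exact: (@flag_width _ S B).
pose U : 'M[R]_m.+1 := \matrix_(k, i) ((ab k).1 0 i - (ab k).2 0 i).
have rowU k : row k U = (ab k).1 - (ab k).2 by apply/rowP => i; rewrite !mxE.
have triU : upper_triangular U.
  by move=> k i ik; have [_ _ E _ _] := abP k; rewrite mxE E// subrr.
have U0 k : 0 < U k k by rewrite mxE; have [] := abP k.
have Uu : U \in unitmx by apply: upper_triangular_unit => // k; rewrite gt_eqF.
pose c : R := (2 * m.+1%:R)^-1.
have c0 : 0 < c by rewrite invr_gt0 mulr_gt0.
pose z : 'rV[R]_m.+1 := \sum_k (c *: (ab k).1 + c *: (ab k).2).
have ztS (t : 'rV[R]_m.+1) : (forall k, `|t 0 k| <= c) -> S (z + t *m U).
  move=> tc; apply: cone_over1.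
  rewrite (_ : 1 = \sum_(k < m.+1) ((c + t 0 k) + (c - t 0 k))); last first.
    rewrite (eq_bigr (fun=> 2 * c)) => [|k _]; last by ring.
    rewrite sumr_const card_ord -mulr_natr /c.
    have : m.+1%:R != 0 :> R by rewrite pnatr_eq0.
    by set M := m.+1%:R => M0; field.
  rewrite (_ : z + t *m U = \sum_(k < m.+1)
      ((c + t 0 k) *: (ab k).1 + (c - t 0 k) *: (ab k).2)); last first.
    rewrite mulmx_sum_row -big_split/=; apply: eq_bigr => k _.
    by rewrite rowU scalerBr addrACA -scalerDl -scalerBl.
  apply: cone_over_sum => // k; have := tc k; rewrite ler_norml => /andP[? ?].
  have [? ? _ _ _] := abP k.
  by apply: cone_overD => //; apply: cone_overZ => //; lra.
have Sz : S z.
  have := ztS 0; rewrite mul0mx addr0; apply => k.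
  by rewrite mxE normr0 ltW.
exists z, U; split => // x Sx.
pose t := (x - z) *m invmx U.
pose tail j := \sum_(k < m.+1 | (j <= k)%N) t 0 k *: row k U.
have tail0 : tail 0%N = x - z.
  by rewrite -[RHS](mulmxKV Uu) -/t mulmx_sum_row.
have tailS (j : 'I_m.+1) : tail j = t 0 j *: row j U + tail j.+1.
  rewrite /tail (bigD1 j)//=; congr (_ + _); apply: eq_bigl => k.
  by rewrite ltn_neqAle andbC eq_sym.
have tail_coord (j : nat) (i : 'I_m.+1) : (i < j)%N -> tail j 0 i = 0.
  move=> ij; rewrite /tail summxE big1// => k jk.
  by rewrite mxE [row k U _ _]mxE triU ?mulr0// (leq_trans ij jk).
(* The coordinates are peeled off one by one. [tail j] vanishes in the first j coordinates, so x'
   and y' agree there and their j-th coordinates differ by at most twice U_jj, which bounds t_j by 2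
   * 3 ^+ j. Removing t_j times row j, a multiple of a difference of points of S, adds at most 2 * 3
   ^+ j to the dilation factor: hence the powers of 3. *)
suff : forall j, (j <= m.+1)%N -> (forall k : 'I_m.+1, (k < j)%N -> `|t 0 k| <= 2 * 3 ^+ k) /\
    exists x' y', [/\ S x', S y' & tail j = 3 ^+ j *: (x' - y')].
  move=> /(_ m.+1 (leqnn _))[h _] k; apply: le_trans (h k (ltn_ord k)) _.
  by rewrite ler_pM2l// ler_weXn2l// ?ler1n// ltnW.
elim=> [_|j IH jm].
  by split => //; exists x, z; rewrite expr0 scale1r.
have [ht [x' [y' [Sx' Sy' tailj]]]] := IH (ltnW jm).
pose J := Ordinal jm.
have tJ : `|t 0 J| <= 2 * 3 ^+ j.
  have xy (i : 'I_m.+1) : (i < J)%N -> x' 0 i = y' 0 i.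
    move=> ij; have := tail_coord j i ij; rewrite tailj !mxE => /eqP.
    by rewrite mulf_eq0 expf_eq0 pnatr_eq0 andbF/= subr_eq0 => /eqP.
  have [_ _ _ w0 /(_ x' y' Sx' Sy' xy) h] := abP J.
  have : t 0 J * ((ab J).1 0 J - (ab J).2 0 J) = 3 ^+ j * (x' 0 J - y' 0 J).
    have := congr1 (fun v : 'rV[R]_m.+1 => v 0 J) (tailS J).
    by rewrite /= tailj rowU !mxE (tail_coord j.+1)// addr0 => ->.
  move=> /(congr1 Num.norm); rewrite !normrM (gtr0_norm w0) normrX.
  rewrite (ger0_norm (ler0n _ _)) => E.
  by rewrite -(ler_pM2r w0) E -mulrA mulrCA ler_pM2l ?exprn_gt0.
split.
  move=> k; rewrite ltnS leq_eqVlt => /orP[/eqP kj|]; last exact: ht.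
  by rewrite (_ : k = J) //; apply/val_inj.
have -> : tail j.+1 = 3 ^+ j *: (x' - y') - t 0 J *: row J U.
  by rewrite -tailj (tailS J) addrC addKr.
pose E : R := 3 ^+ j.
have E0 : 0 < E by rewrite exprn_gt0.
have [p [q [Sp Sq ->]]] : exists p q, [/\ S p, S q &
    - (t 0 J *: row J U) = `|t 0 J| *: (p - q)].
  have [? ? _ _ _] := abP J.
  have [t0|t0] := ger0P (t 0 J).
    by exists (ab J).2, (ab J).1; split=> //; rewrite rowU -scalerN opprB.
  by exists (ab J).1, (ab J).2; split=> //; rewrite rowU -scaleNr.
set T := `|t 0 J| in tJ *.
have T0 : 0 <= T by rewrite normr_ge0.
have P0 : 0 < E + T + (2 * E - T) by lra.
have PE : E + T + (2 * E - T) = 3 ^+ j.+1 by rewrite exprS -/E; ring.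
have TE : 0 <= 2 * E - T by rewrite subr_ge0.
(* The weights E, T and 2E - T add up to 3 ^+ j.+1; the multiple of z only completes the convex
   combination and cancels in the difference. *)
exists ((3 ^+ j.+1)^-1 *: (E *: x' + T *: p + (2 * E - T) *: z)).
exists ((3 ^+ j.+1)^-1 *: (E *: y' + T *: q + (2 * E - T) *: z)).
rewrite -PE; split.
- apply: cone_over_gt0 => //.
  by apply: cone_overD => //; [apply: cone_overD => //|]; apply: cone_overZ => //; exact: ltW.
- apply: cone_over_gt0 => //.
  by apply: cone_overD => //; [apply: cone_overD => //|]; apply: cone_overZ => //; exact: ltW.
rewrite -scalerBr scalerA divff ?gt_eqF// scale1r !scalerBr -/E.
by rewrite [in RHS]opprD [in RHS]addrACA subrr addr0 [in RHS]opprD addrACA.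
Qed.

End convex_parallelepiped.

(** * Interleaved real coordinates and complex determinants *)

Section pairing.
Context {n : nat}.

Fact pair_index_subproof (i : 'I_(n + n)) :
  (match fintype.split i with inl j => (j : nat).*2 | inr j => (j : nat).*2.+1 end
   < n + n)%N.
Proof.
by case: splitP => j _; have := ltn_ord j; rewrite -!addnn; lia.
Qed.

(* Position of a real coordinate in the order Re z^1, Im z^1, Re z^2, ... *)
Definition pair_index (i : 'I_(n + n)) : 'I_(n + n) :=
  Ordinal (@pair_index_subproof i).

Lemma pair_index_lshift (j : 'I_n) :
  pair_index (lshift n j) = j.*2 :> nat.
Proof. by rewrite /= (unsplitK (inl j)). Qed.

Lemma pair_index_rshift (j : 'I_n) :
  pair_index (rshift n j) = j.*2.+1 :> nat.
Proof. by rewrite /= (unsplitK (inr j)). Qed.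

Lemma pair_index_inj : injective pair_index.
Proof.
move=> i k; have [j ->|j ->] := split_ordP i; have [l ->|l ->] := split_ordP k;
  move=> /(congr1 val); rewrite /= ?(unsplitK (inl _)) ?(unsplitK (inr _)).
- by move=> /double_inj/val_inj->.
- by move/(congr1 odd); rewrite /= !odd_double.
- by move/(congr1 odd); rewrite /= !odd_double.
- by move=> [] /double_inj/val_inj->.
Qed.

(** In the interleaved order a triangular real matrix is block triangular with 2 by 2 blocks, one
    for each complex coordinate, and so induces a triangular complex matrix. *)
Definition pair_perm : {perm 'I_(n + n)} := perm pair_index_inj.

End pairing.

Section sqnormC.
Context {R : realType}.
Local Open Scope complex_scope.

Definition sqnormC (z : R[i]) : R := complex.Re z ^+ 2 + complex.Im z ^+ 2.

Lemma sqnormC_ge0 z : 0 <= sqnormC z.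
Proof. by rewrite addr_ge0// sqr_ge0. Qed.

Lemma sqnormCM z w : sqnormC (z * w) = sqnormC z * sqnormC w.
Proof. by case: z w => [a b] [c d]; rewrite /sqnormC /=; ring. Qed.

Lemma sqnormC_prod (I : finType) (z : I -> R[i]) :
  sqnormC (\prod_i z i) = \prod_i sqnormC (z i).
Proof.
apply: (big_morph sqnormC sqnormCM).
by rewrite /sqnormC /= expr1n expr0n addr0.
Qed.

Lemma conjC_mul_sqnorm (z : R[i]) : (z^* * z)%R = (sqnormC z)%:C.
Proof. by case: z => a b; rewrite /sqnormC /=; simpc; congr (_ +i* _); ring. Qed.

(* [complexify w] is the row vector gamma with Re (gamma . z) = <w, z>. *)
Definition complexify n (w : 'I_n -> 'rV[R]_(n + n)) : 'M[R[i]]_n :=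
  \matrix_(j, l) (w j 0 (lshift n l) +i* - w j 0 (rshift n l)).

(* Of the two real forms attached to each complex coordinate, keep the one with
   the larger diagonal entry; the resulting complex matrix is triangular. *)
Lemma det_complexify_ge n (W : 'M[R]_(n + n)) :
  upper_triangular W \/ upper_triangular W^T -> (forall k, 0 < W k k) ->
  exists kappa : 'I_n -> 'I_(n + n),
    \prod_k W k k <=
    sqnormC (\det (complexify (fun j => col_perm pair_perm (row (kappa j) W)))).
Proof.
move=> triW W0.
pose k0 j := pair_index (lshift n j); pose k1 j := pair_index (rshift n j).
pose kappa j := if W (k1 j) (k1 j) <= W (k0 j) (k0 j) then k0 j else k1 j.
have kE j : kappa j = j.*2 :> nat \/ kappa j = j.*2.+1 :> nat.
  by rewrite /kappa; case: ifP => _; rewrite ?pair_index_lshift ?pair_index_rshift; [left|right].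
exists kappa; set G := complexify _.
have GE j l : G j l = W (kappa j) (k0 l) +i* - W (kappa j) (k1 l).
  by rewrite !mxE !permE.
(* The kept diagonal entry is, up to sign, the real or the imaginary part of [G j j], and its square
   dominates the product of the two candidates. *)
have Gdiag j : W (k0 j) (k0 j) * W (k1 j) (k1 j) <= sqnormC (G j j).
  rewrite GE /sqnormC /= sqrrN /kappa.
  have := W0 (k0 j); have := W0 (k1 j); have := lexx (W (k0 j) (k0 j)).
  case: ifPn => [h _ ? ?|]; last rewrite -ltNge => h _ ? ?.
    rewrite (le_trans (_ : _ <= W (k0 j) (k0 j) ^+ 2))//.
      by rewrite expr2 ler_pM2l.
    by rewrite lerDl sqr_ge0.
  rewrite (le_trans (_ : _ <= W (k1 j) (k1 j) ^+ 2))//.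
    by rewrite expr2 ler_pM2r// ltW.
  by rewrite lerDr sqr_ge0.
have detG : \det G = \prod_j G j j.
  case: triW => tri.
    apply: det_upper_triangular => j l lj; rewrite GE !tri ?oppr0//.
    - by rewrite pair_index_rshift; have [->|->] := kE j; lia.
    - by rewrite pair_index_lshift; have [->|->] := kE j; lia.
  have {}tri (a b : 'I_(n + n)) : (a < b)%N -> W a b = 0.
    by move=> ab; have := tri b a ab; rewrite mxE.
  apply: det_trig; apply/is_trig_mxP => j l lj; rewrite GE !tri ?oppr0//.
  - by rewrite pair_index_rshift; have [->|->] := kE j; lia.
  - by rewrite pair_index_lshift; have [->|->] := kE j; lia.
rewrite detG sqnormC_prod.
rewrite (_ : \prod_k W k k = \prod_j (W (k0 j) (k0 j) * W (k1 j) (k1 j))).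
  by apply: ler_prod => j _; rewrite Gdiag mulr_ge0// ltW.
by rewrite (reindex_inj pair_index_inj) big_split_ord [RHS]big_split.
Qed.

End sqnormC.

(** * Frames of a convex set in complex coordinates *)

Section frames.
Context {R : realType}.
Local Notation mu m := (@lebesgue_rV R m).

Definition dotp m (p x : 'rV[R]_m) : R := \sum_i p 0 i * x 0 i.

Lemma norm_le_coord m (x : 'rV[R]_m) (B : R) :
  0 <= B -> (forall i, `|x 0 i| <= B) -> `|x| <= B.
Proof.
move=> B0 xB; rewrite [leLHS]/Num.norm/= mx_normrE.
by apply/bigmax_leP; split => // -[i j] _ /=; rewrite ord1.
Qed.

Lemma open_col_perm m (s : {perm 'I_m}) (S : set 'rV[R]_m) :
  open S -> open [set x | S (col_perm s x)].
Proof.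
move=> oS; rewrite openE => x /= Sx.
have /nbhs_ballP[e /= e0 xS] : nbhs (col_perm s x) S by exact: open_nbhs_nbhs.
apply/nbhs_ballP; exists e => //= y [_ xy]; apply: xS; split=> // i j.
by rewrite !mxE ord1; exact: xy.
Qed.

Lemma measurable_parallelepiped m (V : 'M[R]_m) (b : 'rV[R]_m) (a : R) :
  measurable [set x : 'rV[R]_m | forall k, `|(x *m V) 0 k - b 0 k| <= a].
Proof.
have mV : measurable_fun [set: 'rV[R]_m] (fun x : 'rV[R]_m => x *m V).
  apply: measurable_fun_rVP => k; under eq_fun do rewrite mxE.
  apply: measurable_sum => i; apply: measurable_funM => //.
  exact: measurable_coord_rV.
pose A k := `[b 0 k - a, b 0 k + a]%classic.
rewrite [X in measurable X](_ : _ = (fun x => x *m V) @^-1` box A).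
  rewrite -[X in measurable X]setTI; apply: mV => //.
  by apply: measurable_box => k; exact: measurable_itv.
by apply/seteqP; split=> x /= h k; have := h k; rewrite /A/= in_itv/= ler_distl.
Qed.

Lemma convex_parallelepiped_gt0 m (S : set 'rV[R]_m) (B : R) : (0 < m)%N ->
  open S -> S !=set0 -> (forall x, S x -> `|x| <= B) -> convex_rV S ->
  exists z (U : 'M[R]_m), [/\ upper_triangular U, forall k, 0 < U k k,
    forall t : 'rV_m, (forall k, `|t 0 k| <= (2 * m%:R)^-1) -> S (z + t *m U) &
    forall x, S x -> forall k, `|((x - z) *m invmx U) 0 k| <= 2 * 3 ^+ m].
Proof. by case: m S => // m S _; exact: convex_parallelepiped. Qed.

(* [D] is comparable to the volume of S; [w] spans a parallelepiped inside S and
   [w'] is dual to one containing S. *)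
Lemma convex_frames n (S : set 'rV[R]_(n + n)) (B : R) : (0 < n)%N ->
  open S -> S !=set0 -> (forall x, S x -> `|x| <= B) -> convex_rV S ->
  exists z D (w w' : 'I_n -> 'rV[R]_(n + n)), [/\ 0 < D,
    (((n + n)%:R^-1 ^+ (n + n) * D)%:E <= mu _ S)%E,
    (mu _ S <= ((4 * 3 ^+ (n + n)) ^+ (n + n) * D)%:E)%E,
    (forall j t, `|t| <= (2 * (n + n)%:R)^-1 -> S (z + t *: w j)) /\
      D <= sqnormC (\det (complexify w)) &
    (forall x j, S x -> `|dotp (w' j) (x - z)| <= 2 * 3 ^+ (n + n)) /\
      D^-1 <= sqnormC (\det (complexify w'))].
Proof.
move=> n0 oS [x0 Sx0] bS convS; set m := (n + n)%N.
have m0 : (0 < m)%N by rewrite addn_gt0 n0.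
pose s : {perm 'I_m} := pair_perm.
pose S' := [set x : 'rV[R]_m | S (col_perm s x)].
have permK (x : 'rV[R]_m) : col_perm s (col_perm (s^-1)%g x) = x.
  by rewrite -col_permM mulgV col_perm1.
have permD a b : col_perm s (a + b : 'rV[R]_m) = col_perm s a + col_perm s b.
  by apply/rowP => i; rewrite !mxE.
have permZ a b : col_perm s (a *: b : 'rV[R]_m) = a *: col_perm s b.
  by apply/rowP => i; rewrite !mxE.
have oS' : open S' by exact: open_col_perm.
have B0 : 0 <= B by apply: le_trans (bS _ Sx0).
have bS' x : S' x -> `|x| <= B.
  move=> /bS xB; apply: norm_le_coord => // i.
  rewrite (le_trans _ xB)//; have := coord_le_norm (col_perm s x) ((s^-1)%g i).
  by rewrite mxE permKV.
have convS' : convex_rV S'.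
  by move=> x y a b; rewrite /S'/= permD !permZ; exact: convS.
have S'0 : S' !=set0 by exists (col_perm (s^-1)%g x0); rewrite /S'/= permK.
have [z [U [triU U0 US SU]]] : exists z (U : 'M[R]_m), [/\ upper_triangular U, forall k, 0 < U k k,
    forall t : 'rV_m, (forall k, `|t 0 k| <= (2 * m%:R)^-1) -> S' (z + t *m U) &
    forall x, S' x -> forall k, `|((x - z) *m invmx U) 0 k| <= 2 * 3 ^+ m].
  exact: (@convex_parallelepiped_gt0 _ _ B).
have U_neq0 k : U k k != 0 by rewrite gt_eqF.
have Uu := upper_triangular_unit triU U_neq0.
have [] := invmx_upper_triangular triU U_neq0.
set V := invmx U => triV Vdiag.
have V0 k : 0 < V k k by rewrite Vdiag invr_gt0.
pose D : R := \prod_k U k k.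
have D0 : 0 < D by apply: prodr_gt0.
have prodV : \prod_k V k k = D^-1.
  by rewrite /D -prodfV; apply: eq_bigr => k _; rewrite Vdiag.
have mS' : mu m S = mu m S' by rewrite lebesgue_rV_perm//; exact: open_measurable_rV.
have box_mu a : 0 <= a -> mu m [set x | forall k, `|(x *m V) 0 k - (z *m V) 0 k| <= a] =
    ((2 * a) ^+ m * D)%:E.
  move=> a0; rewrite lebesgue_rV_parallelepiped//; congr EFin.
  rewrite big_split/= prodfV prodV invrK; congr (_ * _).
  by rewrite prodr_const card_ord.
have mbox a : measurable [set x | forall k, `|(x *m V) 0 k - (z *m V) 0 k| <= a].
  exact: measurable_parallelepiped.
have [kap Ukap] := @det_complexify_ge R n U (or_introl triU) U0.
have [kap' Vkap] : exists kappa : 'I_n -> 'I_(n + n),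
    \prod_k V^T k k <=
    sqnormC (\det (complexify (fun j => col_perm pair_perm (row (kappa j) V^T)))).
  apply: det_complexify_ge; first by right; rewrite trmxK.
  by move=> k; rewrite mxE.
(* [w] consists of rows of U, which are edge directions of the inner parallelepiped, and [w'] of
   columns of its inverse, the linear forms bounded on S. As D is the product of the diagonal of U,
   the two determinant bounds are reciprocal. *)
exists (col_perm s z), D, (fun j => col_perm s (row (kap j) U)),
  (fun j => col_perm s (row (kap' j) V^T)); split=> //.
- rewrite mS'.
  rewrite (_ : m%:R^-1 = 2 * (2 * m%:R)^-1 :> R); last first.
    by rewrite invfM mulrA divff ?mul1r// pnatr_eq0.
  rewrite -box_mu; last by rewrite invr_ge0 mulr_ge0.
  rewrite le_measure ?inE//; first exact: open_measurable_rV.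
  move=> x /= h; have := US ((x - z) *m V).
  rewrite mulmxKV// addrCA subrr addr0; apply => k.
  by have := h k; rewrite mulmxBl !mxE.
- rewrite mS' (_ : 4 * 3 ^+ m = 2 * (2 * 3 ^+ m) :> R); last by ring.
  rewrite -box_mu; last by rewrite mulr_ge0// exprn_ge0.
  rewrite le_measure ?inE//; first exact: open_measurable_rV.
  by move=> x /= /SU h k; have := h k; rewrite mulmxBl !mxE.
- split; last exact: Ukap.
  move=> j t tm; have := US (t *: delta_mx 0 (kap j)); rewrite -scalemxAl -rowE.
  rewrite /S'/= permD permZ; apply => k; rewrite !mxE.
  by case: (_ && _); rewrite ?mulr1// mulr0 normr0 invr_ge0 mulr_ge0.
- split; last first.
    apply: le_trans Vkap; rewrite -prodV.
    by under [leRHS]eq_bigr do rewrite mxE.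
  move=> x j Sx; pose x' := col_perm (s^-1)%g x.
  have -> : x = col_perm s x' by rewrite permK.
  have Sx' : S' x' by rewrite /S'/= permK.
  have := SU _ Sx' (kap' j); congr (`|_| <= _).
  rewrite /dotp mxE (reindex_inj (@perm_inj _ s)); apply: eq_bigr => i _.
  by rewrite !mxE mulrC.
Qed.

End frames.

Section dotp_theory.
Context {R : realType} {m : nat}.
Implicit Types p q x y : 'rV[R]_m.

Lemma dotpDl p q x : dotp (p + q) x = dotp p x + dotp q x.
Proof. by rewrite /dotp -big_split; apply: eq_bigr => i _; rewrite mxE mulrDl. Qed.

Lemma dotpZl (a : R) p x : dotp (a *: p) x = a * dotp p x.
Proof. by rewrite /dotp mulr_sumr; apply: eq_bigr => i _; rewrite mxE mulrA. Qed.

Lemma dotpDr p x y : dotp p (x + y) = dotp p x + dotp p y.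
Proof. by rewrite /dotp -big_split; apply: eq_bigr => i _; rewrite mxE mulrDr. Qed.

Lemma dotpZr (a : R) p x : dotp p (a *: x) = a * dotp p x.
Proof. by rewrite /dotp mulr_sumr; apply: eq_bigr => i _; rewrite mxE mulrCA. Qed.

Lemma dotpNr p x : dotp p (- x) = - dotp p x.
Proof. by rewrite -scaleN1r dotpZr mulN1r. Qed.

Lemma dotpNl p x : dotp (- p) x = - dotp p x.
Proof. by rewrite -scaleN1r dotpZl mulN1r. Qed.

Lemma dotpBr p x y : dotp p (x - y) = dotp p x - dotp p y.
Proof. by rewrite dotpDr dotpNr. Qed.

Lemma dotpBl p q x : dotp (p - q) x = dotp p x - dotp q x.
Proof. by rewrite dotpDl dotpNl. Qed.

Lemma dotp_delta p k : dotp p (delta_mx 0 k) = p 0 k.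
Proof.
rewrite /dotp (bigD1 k)//= big1 ?addr0 => [|i ik].
  by rewrite mxE !eqxx mulr1.
by rewrite mxE (negbTE ik) andbF mulr0.
Qed.

Lemma dotp_deltal x k : dotp (delta_mx 0 k) x = x 0 k.
Proof.
rewrite /dotp (bigD1 k)//= big1 ?addr0 => [|i ik].
  by rewrite mxE !eqxx mul1r.
by rewrite mxE (negbTE ik) andbF mul0r.
Qed.

Lemma dotp_le p x (a b : R) : (forall i, `|p 0 i| <= a) -> (forall i, `|x 0 i| <= b) ->
  `|dotp p x| <= m%:R * (a * b).
Proof.
move=> pa xb; rewrite /dotp (le_trans (ler_norm_sum _ _ _))//.
rewrite mulr_natl -[X in _ *+ X]card_ord -sumr_const; apply: ler_sum => i _.
by rewrite normrM ler_pM.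
Qed.

Lemma continuous_dotp p : continuous (dotp p).
Proof.
apply: (@continuous_big _ _ +%R 0) => [|i _ x]; first exact: add_continuous.
by apply: continuousM; [exact: cst_continuous|exact: coord_continuous].
Qed.

End dotp_theory.

(** * Quadratic test functions *)

Section quadratic.
Context {R : realType}.
Local Open Scope complex_scope.
Local Notation iC := (0 +i* 1 : R[i]).

(** The test functions are exact quadratics along every line, so their directional derivatives can
    be read off from an algebraic expansion. *)
Lemma derive_quadratic m (f : 'rV[R]_m -> R) (x v : 'rV[R]_m) (L K : R) :
  (forall h, f (h *: v + x) = f x + h * L + h ^+ 2 * K) -> 'D_v f x = L.
Proof.
move=> fE; apply/cvg_lim => //=.
have LK : (fun h : R => L + h * K) @ 0^' --> L.
  rewrite -[X in _ --> X]addr0 -[X in _ --> _ + X](mul0r K).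
  apply: cvgD; first exact: cvg_cst.
  apply: cvgM; last exact: cvg_cst.
  exact: nbhs_dnbhs.
apply: cvg_trans LK; apply: near_eq_cvg.
near=> h; rewrite /= fE.
have h0 : h != 0 by near: h; exact: nbhs_dnbhs_neq.
rewrite /GRing.scale/=; by field.
Unshelve. all: by end_near. Qed.

Lemma cderive_quadratic n (F : 'rV[R]_(n + n) -> R[i]) (x v : 'rV[R]_(n + n))
    (L K : R[i]) :
  (forall h : R, F (h *: v + x) = F x + h%:C * L + (h ^+ 2)%:C * K) ->
  cderive v F x = L.
Proof.
move=> FE; rewrite /cderive.
have [ReE ImE] : (forall (a b c : R[i]) (h g : R), complex.Re (a + h%:C * b + g%:C * c) =
      complex.Re a + h * complex.Re b + g * complex.Re c) /\
    (forall (a b c : R[i]) (h g : R), complex.Im (a + h%:C * b + g%:C * c) =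
      complex.Im a + h * complex.Im b + g * complex.Im c).
  by split=> [] [? ?] [? ?] [? ?] ? ? /=; ring.
rewrite (@derive_quadratic _ _ _ _ (complex.Re L) (complex.Re K)); last first.
  by move=> h /=; rewrite FE ReE.
rewrite (@derive_quadratic _ _ _ _ (complex.Im L) (complex.Im K)); last first.
  by move=> h /=; rewrite FE ImE.
by case: (L).
Qed.

Lemma num_conjE (z : R[i]) : (z^*)%R = conjc z.
Proof. by []. Qed.

Definition hform n (A : 'M[R[i]]_n) (x y : 'rV[R]_(n + n)) : R[i] :=
  \sum_i \sum_j A j i * zcoord x i * (zcoord y j)^*.

Lemma zcoordD n (x y : 'rV[R]_(n + n)) k : zcoord (x + y) k = zcoord x k + zcoord y k.
Proof. by rewrite /zcoord !mxE; simpc. Qed.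

Lemma zcoordZ n (h : R) (x : 'rV[R]_(n + n)) k : zcoord (h *: x) k = h%:C * zcoord x k.
Proof. by rewrite /zcoord !mxE; simpc. Qed.

Lemma zcoord_dx n (k i : 'I_n) :
  zcoord (delta_mx 0 (lshift n k) : 'rV[R]_(n + n)) i = (i == k)%:R.
Proof.
rewrite /zcoord !mxE !eqxx/= eq_lshift eq_rlshift.
by case: (i == k).
Qed.

Lemma zcoord_dy n (k i : 'I_n) :
  zcoord (delta_mx 0 (rshift n k) : 'rV[R]_(n + n)) i = (i == k)%:R * iC.
Proof.
rewrite /zcoord !mxE !eqxx/= eq_rshift eq_lrshift.
by case: (i == k); simpc.
Qed.

(** The derivative in direction v is A(v, x) + A(x, v); the combination defining [dzbar] kills the
    first term, complex linear in v, and keeps the second, which is antilinear. *)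
Lemma dzbar_hform n (A : 'M[R[i]]_n) k (x : 'rV[R]_(n + n)) :
  dzbar k (fun y => hform A y y) x = \sum_i A k i * zcoord x i.
Proof.
have E v : cderive v (fun y => hform A y y) x = hform A v x + hform A x v.
  apply: (@cderive_quadratic _ _ _ _ _ (hform A v v)) => h.
  rewrite /hform mulrDr !mulr_sumr -!big_split/=; apply: eq_bigr => i _.
  rewrite !mulr_sumr -!big_split/=; apply: eq_bigr => j _.
  rewrite !zcoordD !zcoordZ.
  move: (zcoord v i) (zcoord x i) (A j i) => a b c.
  case: (zcoord v j) (zcoord x j) => [d e] [d' e'].
  rewrite !num_conjE.
  have -> : (h%:C * (d +i* e) + (d' +i* e'))^* = h%:C * (d +i* e)^* + (d' +i* e')^*.
    by rewrite /=; simpc; congr (_ +i* _); ring.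
  have -> : (h ^+ 2)%:C = h%:C * h%:C :> R[i] by simpc; congr (_ +i* _); ring.
  by ring.
rewrite /dzbar !E.
have S1 : hform A (delta_mx 0 (lshift n k)) x = \sum_j A j k * (zcoord x j)^*.
  rewrite /hform (bigD1 k)//= [X in _ + X]big1 ?addr0 => [|i ik].
    by apply: eq_bigr => j _; rewrite zcoord_dx eqxx mulr1.
  by rewrite big1// => j _; rewrite zcoord_dx (negbTE ik) mulr0 mul0r.
have S2 : hform A (delta_mx 0 (rshift n k)) x = iC * \sum_j A j k * (zcoord x j)^*.
  rewrite /hform (bigD1 k)//= [X in _ + X]big1 ?addr0 => [|i ik].
    by rewrite mulr_sumr; apply: eq_bigr => j _; rewrite zcoord_dy eqxx mul1r; ring.
  by rewrite big1// => j _; rewrite zcoord_dy (negbTE ik) mul0r mulr0 mul0r.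
have S3 : hform A x (delta_mx 0 (lshift n k)) = \sum_i A k i * zcoord x i.
  apply: eq_bigr => i _; rewrite (bigD1 k)//= big1 ?addr0 => [|j jk].
    by rewrite zcoord_dx eqxx rmorph1 mulr1.
  by rewrite zcoord_dx (negbTE jk) rmorph0 mulr0.
have S4 : hform A x (delta_mx 0 (rshift n k)) = - iC * \sum_i A k i * zcoord x i.
  rewrite mulr_sumr; apply: eq_bigr => i _; rewrite (bigD1 k)//= big1 ?addr0 => [|j jk].
    by rewrite zcoord_dy eqxx rmorphM rmorph1 mul1r mulrC; congr (_ * _); simpc; rewrite /= ?oppr0.
  by rewrite zcoord_dy (negbTE jk) mul0r rmorph0 mulr0.
rewrite S1 S2 S3 S4.
set P := \sum_j _; set Q := \sum_i _.
have ii : iC * iC = -1 :> R[i] by simpc.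
move: ii; move: iC => I ii.
have -> : P + Q + I * (I * P + - I * Q) = P + Q + (I * I) * (P - Q) by ring.
by rewrite ii; field.
Qed.

Lemma dz_linear n (a : 'I_n -> R[i]) k (x : 'rV[R]_(n + n)) :
  dz k (fun y => \sum_i a i * zcoord y i) x = a k.
Proof.
have E v : cderive v (fun y => \sum_i a i * zcoord y i) x = \sum_i a i * zcoord v i.
  apply: (@cderive_quadratic _ _ _ _ _ 0) => h.
  rewrite mulr0 addr0 mulr_sumr -big_split/=; apply: eq_bigr => i _.
  by rewrite zcoordD zcoordZ; ring.
rewrite /dz !E (bigD1 k)//= big1 ?addr0 => [|i ik]; last first.
  by rewrite zcoord_dx (negbTE ik) mulr0.
rewrite (bigD1 k)//= big1 ?addr0 => [|i ik]; last first.
  by rewrite zcoord_dy (negbTE ik) mul0r mulr0.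
rewrite zcoord_dx zcoord_dy eqxx mulr1 mul1r.
have ii : iC * iC = -1 :> R[i] by simpc.
move: ii; move: iC => I ii.
have -> : a k - I * (a k * I) = a k - (I * I) * a k by ring.
by rewrite ii; field.
Qed.

Lemma MC_hform n (A : 'M[R[i]]_n) (p : 'rV[R]_(n + n) -> R) x :
  (forall y, (p y)%:C = hform A y y) -> MC p x = complex.Re (\det (2 *: A)).
Proof.
move=> pE; rewrite /MC; congr (complex.Re (\det _)).
apply/matrixP => j i; rewrite !mxE; congr (_ * _).
rewrite (_ : (fun y => (p y)%:C) = (fun y => hform A y y)); last exact/funext.
rewrite (_ : dzbar j _ = (fun y => \sum_i A j i * zcoord y i)).
  exact: dz_linear.
by apply/funext => y; exact: dzbar_hform.
Qed.

End quadratic.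

(** * Sums of squares of real linear forms as test functions *)

Section touching.
Context {R : realType}.
Local Open Scope complex_scope.

Definition clin n (v x : 'rV[R]_(n + n)) : R[i] :=
  \sum_l (v 0 (lshift n l) +i* - v 0 (rshift n l)) * zcoord x l.

Lemma Re_sum (I : finType) (F : I -> R[i]) :
  complex.Re (\sum_i F i) = \sum_i complex.Re (F i).
Proof. by apply: (big_morph (@complex.Re R)) => // -[? ?] [? ?]. Qed.

Lemma Re_clin n (v x : 'rV[R]_(n + n)) : complex.Re (clin v x) = dotp v x.
Proof.
rewrite /clin /dotp big_split_ord/= -big_split/= Re_sum.
by apply: eq_bigr => l _; rewrite /zcoord /=; ring.
Qed.

Lemma real_complexM (a b : R) : (a * b)%:C = a%:C * b%:C.
Proof. by simpc; congr (_ +i* _); ring. Qed.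

Lemma real_complex_sum (I : finType) (F : I -> R) :
  (\sum_i F i)%:C = \sum_i (F i)%:C.
Proof. by apply: (big_morph (fun a : R => a%:C)) => // a b; simpc; congr (_ +i* _); ring. Qed.

Definition gram n (c : R) (G : 'M[R[i]]_n) : 'M[R[i]]_n :=
  \matrix_(j, i) (c%:C * \sum_k (G k j)^* * G k i).

Lemma gram_form n (c : R) (G : 'M[R[i]]_n) (v : 'I_n -> R[i]) :
  \sum_i \sum_j gram c G j i * v i * (v j)^* =
  (c * \sum_k sqnormC (\sum_l G k l * v l))%:C.
Proof.
rewrite real_complexM real_complex_sum.
rewrite [in RHS](eq_bigr (fun k => \sum_i \sum_j ((G k j)^* * G k i * v i * (v j)^*))); last first.
  move=> k _; rewrite -conjC_mul_sqnorm rmorph_sum mulr_suml exchange_big/=.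
  apply: eq_bigr => i _; rewrite mulr_sumr; apply: eq_bigr => j _.
  by rewrite rmorphM; ring.
rewrite [in RHS]exchange_big mulr_sumr; apply: eq_bigr => i _.
rewrite [in RHS]exchange_big mulr_sumr; apply: eq_bigr => j _.
rewrite mxE -!mulrA; congr (_ * _); rewrite mulr_suml.
by apply: eq_bigr => k _; ring.
Qed.

Lemma gram_nonneg_hermitian n (c : R) (G : 'M[R[i]]_n) :
  0 <= c -> nonneg_hermitian (gram c G).
Proof.
move=> c0; split.
  rewrite qualifE/=; apply/eqP/matrixP => i j; rewrite expr0 scale1r !mxE.
  rewrite rmorphM rmorph_sum; congr (_ * _); first by rewrite /= num_conjE conjc_real.
  by apply: eq_bigr => k _; rewrite rmorphM/= conjCK mulrC.
move=> v; rewrite gram_form lecR.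
by rewrite mulr_ge0// sumr_ge0// => k _; exact: sqnormC_ge0.
Qed.

Lemma det_gram n (c : R) (G : 'M[R[i]]_n) :
  complex.Re (\det (2 *: gram (c / 2) G)) = c ^+ n * sqnormC (\det G).
Proof.
have -> : 2 *: gram (c / 2) G = c%:C *: ((map_mx Num.conj G)^T *m G).
  apply/matrixP => i j; rewrite !mxE mulrA; congr (_ * _).
    by rewrite real_complexM fmorphV/=; field.
  by apply: eq_bigr => k _; rewrite !mxE.
rewrite detZ det_mulmx det_tr det_map_mx/= num_conjE conjC_mul_sqnorm.
have -> : c%:C ^+ n = (c ^+ n)%:C :> R[i] by rewrite rmorphXn.
by rewrite /= mul0r subr0.
Qed.

(** If gamma is the complex linear form with real part <w, x>, then (Re gamma)^2 = |gamma|^2 / 2 +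
    Re (gamma^2) / 2. The first half belongs to [Tplus]; the second half and the affine terms form
    the real part of a holomorphic polynomial. The factor 2 in [MC] makes up for the 1/2. *)
Lemma viscosity_quadratic n (Omega : set 'rV[R]_(n + n)) f u
    (w : 'I_n -> 'rV[R]_(n + n)) (b x' x1 : 'rV[R]_(n + n)) (kappa lam : R) :
  viscosity_supersolution Omega f u -> Omega x1 -> 0 <= lam ->
  touches_below
    (fun x => kappa + dotp b x + lam * \sum_j dotp (w j) (x - x') ^+ 2) u x1 ->
  lam ^+ n * sqnormC (\det (complexify w)) <= f x1.
Proof.
move=> [_ _ visc] Ox1 lam0 touch.
set G := complexify w.
pose p (x : 'rV[R]_(n + n)) := lam / 2 * \sum_k sqnormC (\sum_l G k l * zcoord x l).
have pE x : (p x)%:C = hform (gram (lam / 2) G) x x by rewrite /hform gram_form.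
rewrite -det_gram -(@MC_hform _ _ _ _ x1 pE).
pose b2 := b - (2 * lam) *: \sum_k dotp (w k) x' *: w k.
pose k2 := kappa + lam * \sum_k dotp (w k) x' ^+ 2.
pose h x := k2%:C + \sum_i (b2 0 (lshift n i) +i* - b2 0 (rshift n i)) * zcoord x i
  + \sum_i \sum_j ((lam / 2)%:C * \sum_k G k i * G k j) * zcoord x i * zcoord x j.
apply: (visc p _ h) => //.
- by exists (gram (lam / 2) G) => //; apply: gram_nonneg_hermitian; rewrite divr_ge0.
- exists k2%:C, (fun i => b2 0 (lshift n i) +i* - b2 0 (rshift n i)),
    (fun i j => (lam / 2)%:C * \sum_k G k i * G k j) => //.
rewrite (_ : (fun x => _) =
    fun x => kappa + dotp b x + lam * \sum_j dotp (w j) (x - x') ^+ 2)//.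
apply/funext => x; rewrite /h.
have -> : \sum_i \sum_j ((lam / 2)%:C * \sum_k G k i * G k j) * zcoord x i * zcoord x j
   = (lam / 2)%:C * \sum_k (clin (w k) x) ^+ 2.
  rewrite [in RHS](eq_bigr (fun k => \sum_i \sum_j (G k i * zcoord x i) * (G k j * zcoord x j))).
    rewrite [in RHS]exchange_big mulr_sumr; apply: eq_bigr => i _.
    rewrite [in RHS]exchange_big mulr_sumr; apply: eq_bigr => j _.
    by rewrite -!mulrA; congr (_ * _); rewrite mulr_suml; apply: eq_bigr => k _; ring.
  move=> k _; rewrite expr2 /clin mulr_suml; apply: eq_bigr => i _.
  by rewrite mulr_sumr; apply: eq_bigr => j _; rewrite !mxE.
rewrite -/(clin b2 x) !raddfD/= Re_clin.
have -> : complex.Re ((lam / 2)%:C * \sum_k clin (w k) x ^+ 2) =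
   lam / 2 * \sum_k complex.Re (clin (w k) x ^+ 2).
  rewrite -Re_sum.
  by case: (\sum_k _) => ? ? /=; ring.
have -> : dotp b2 x = dotp b x - 2 * lam * \sum_k dotp (w k) x' * dotp (w k) x.
  rewrite dotpDl -scaleNr dotpZl mulNr; congr (_ - _ * _).
  rewrite (big_morph (fun a => dotp a x) (id1 := 0) (op1 := +%R)) //.
  - by apply: eq_bigr => k _; rewrite dotpZl.
  - by move=> ? ?; exact: dotpDl.
  - by rewrite /dotp big1// => i _; rewrite mxE mul0r.
rewrite /p /k2.
have -> : \sum_k sqnormC (\sum_l G k l * zcoord x l) = \sum_k sqnormC (clin (w k) x).
  by apply: eq_bigr => k _; congr sqnormC; apply: eq_bigr => l _; rewrite mxE.
have -> : \sum_j dotp (w j) (x - x') ^+ 2 =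
   2^-1 * (\sum_k sqnormC (clin (w k) x)) + 2^-1 * (\sum_k complex.Re (clin (w k) x ^+ 2))
   - 2 * (\sum_k dotp (w k) x' * dotp (w k) x) + \sum_k dotp (w k) x' ^+ 2.
  rewrite !mulr_sumr -sumrN -!big_split/=; apply: eq_bigr => k _.
  by rewrite dotpBr -[dotp _ x]Re_clin /sqnormC; case: (clin (w k) x) => ? ? /=; field.
by field.
Qed.

End touching.

(** * Existence of a touching point *)

Section touching_minimum.
Context {R : realType} {n : nat} (Om : set 'rV[R]_(n + n)).
Context (f u : 'rV[R]_(n + n) -> R).
Hypothesis oOm : open Om.
Hypothesis cOm : compact (closure Om).
Hypothesis cu : {within closure Om, continuous u}.
Hypothesis visc : viscosity_supersolution Om f u.
Hypothesis u_ge0 : forall x, boundary Om x -> 0 <= u x.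

Lemma continuous_at_open x : Om x -> {for x, continuous u}.
Proof.
move=> Ox.
have : {within Om, continuous u} by apply: continuous_subspaceW cu; exact: subset_closure.
by rewrite continuous_open_subspace// => /(_ x); apply; rewrite inE.
Qed.

(* The quadratic is truncated at [bet] so that the minimum over all of
   [closure Om] is attained at a point where the truncation is inactive. *)
Lemma touching_minimum (w : 'I_n -> 'rV[R]_(n + n)) (b x' x0 : 'rV[R]_(n + n))
    (kappa lam the e bet : R) :
  0 <= lam -> 0 <= bet -> closure Om x0 -> u x0 - (kappa + dotp b x0) <= e ->
  (forall y, closure Om y -> u y - (kappa + dotp b y) <= the ->
    lam * \sum_j dotp (w j) (y - x') ^+ 2 <= bet) ->
  e + bet < the ->
  (forall y, closure Om y -> kappa + dotp b y + (e + bet) < 0) ->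
  exists y, [/\ Om y, u y - (kappa + dotp b y) <= e + bet &
    lam ^+ n * sqnormC (\det (complexify w)) <= f y].
Proof.
move=> lam0 bet0 Ox0 ux0 quad_le ebt neg.
pose q (y : 'rV[R]_(n + n)) := lam * \sum_j dotp (w j) (y - x') ^+ 2.
have q0 y : 0 <= q y by rewrite mulr_ge0// sumr_ge0// => j _; exact: sqr_ge0.
have cq : continuous q.
  have cs : continuous (fun y : 'rV[R]_(n + n) => \sum_j dotp (w j) (y - x') ^+ 2).
    apply: (@continuous_big _ _ +%R 0) => [|j _ y]; first exact: add_continuous.
    apply: (@continuous_comp _ _ _ (fun y : 'rV[R]_(n + n) => dotp (w j) (y - x'))
      (fun t => t ^+ 2)).
      apply: (@continuous_comp _ _ _ (fun y : 'rV[R]_(n + n) => y - x') (dotp (w j))).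
        by apply: continuousB; [exact: cvg_id|exact: cst_continuous].
      exact: continuous_dotp.
    exact: exprn_continuous.
  by move=> y; apply: continuousM; [exact: cst_continuous|exact: cs].
pose L (y : 'rV[R]_(n + n)) := kappa + dotp b y.
have cL : continuous L.
  by move=> y; apply: continuousD; [exact: cst_continuous|exact: continuous_dotp].
pose F (y : 'rV[R]_(n + n)) := u y - (L y + Num.min (q y) bet).
have cF : {within closure Om, continuous F}.
  pose F2 (y : 'rV[R]_(n + n)) := L y + Num.min (q y) bet.
  have cF2 : continuous F2.
    move=> y; apply: continuousD; first exact: cL.
    by apply: continuous_min; [exact: cq|exact: cst_continuous].
  move=> y; exact: (continuousB (cu (x := y)) (continuous_subspaceT cF2 (x := y))).
have [|y yO ymin] := EVT_min_rV _ cOm cF; first by exists x0.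
rewrite inE in yO.
have Fx0 : F x0 <= e.
  by rewrite /F /L opprD addrA lerBlDr (le_trans ux0)// lerDl le_min q0.
have wy : u y - L y <= e + bet.
  have := le_trans (ymin x0 (mem_set Ox0)) Fx0.
  rewrite /F opprD addrA lerBlDr => /le_trans; apply.
  by rewrite lerD2l ge_min lexx orbT.
(* On the boundary u >= 0, whereas u y is at most the affine function plus e + bet, which is
   negative. *)
have yOm : Om y.
  apply: contrapT => nOy; have : 0 <= u y.
    by apply: u_ge0; split => // /interior_subset.
  have := neg y yO; move: wy; rewrite /L; lra.
exists y; split => //.
(* The shifted constant makes the untruncated quadratic equal to u at y. Near y the gap u - L stays
   below [the], so q <= bet and the truncation has no effect there. *)
apply: (viscosity_quadratic (x1 := y) (b := b) (x' := x')
  (kappa := kappa + (u y - L y) - q y) visc) => //.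
have qy : q y <= bet by apply: quad_le => //; rewrite (le_trans wy)// ltW.
split; first by rewrite /= -/(q y) /L; ring.
have : \forall z \near y, u z - L z < the.
  have : (fun z => u z - L z) @ y --> u y - L y.
    by apply: continuousB; [exact: continuous_at_open|exact: cL].
  by move/cvgr_lt; apply; exact: le_lt_trans ebt.
have : \forall z \near y, Om z by exact: open_nbhs_nbhs.
apply: filterS2 => z Oz wz.
have Oz' := subset_closure Oz.
have qz : q z <= bet by apply: quad_le => //; exact: ltW.
have := ymin z (mem_set Oz').
by rewrite /F (min_idPl qy) (min_idPl qz) /= -/(q z) /L; lra.
Qed.

End touching_minimum.

(** * The envelope of affine minorants *)

Section lipschitz_rV.
Context {R : realType} {m : nat}.

Lemma lipschitz_rV_continuous (F : 'rV[R]_m -> R) (L : R) :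
  (forall x y, F x - F y <= L * `|x - y|) -> continuous F.
Proof.
move=> FL x A /nbhs_ballP[e /= e0 eA].
have L1 : 0 < `|L| + 1 by rewrite ltr_wpDl.
have LL z : L * `|z : 'rV[R]_m| <= (`|L| + 1) * `|z|.
  by rewrite ler_wpM2r// (le_trans (ler_norm _))// lerDl.
apply/nbhs_ballP; exists (e / (`|L| + 1)) => /=; first by rewrite divr_gt0.
move=> y; rewrite -ball_normE /= ltr_pdivlMr// mulrC => xy.
apply: eA; rewrite -ball_normE /=.
rewrite (le_lt_trans _ xy)// ler_norml lerNl opprB; apply/andP; split.
  by rewrite (le_trans (FL _ _))// distrC LL.
by rewrite (le_trans (FL _ _))// LL.
Qed.

Lemma continuous_measurable_rV (F : 'rV[R]_m -> R) :
  continuous F -> measurable_fun setT F.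
Proof.
move=> /continuousP cF; apply: (measurability _ (RGenOpens.measurableE R)).
move=> _ [_ [a [b ->] <-]]; rewrite setTI; apply: open_measurable_rV.
by apply: cF; exact: interval_open.
Qed.

Lemma open_lt_continuous (F H : 'rV[R]_m -> R) : continuous F -> continuous H ->
  open [set x | F x < H x].
Proof.
move=> cF cH; rewrite (_ : mkset _ = (fun x => H x - F x) @^-1` [set t | 0 < t]).
  apply: open_comp; last exact: open_gt.
  by move=> x _; apply: continuousB; [exact: cH|exact: cF].
by apply/seteqP; split=> x /=; rewrite subr_gt0.
Qed.

Lemma continuous_dotpB (p c : 'rV[R]_m) : continuous (fun x : 'rV[R]_m => dotp p (x - c)).
Proof.
apply: (@lipschitz_rV_continuous _ (m%:R * `|p|)) => x y.
rewrite -dotpBr opprB addrA subrK (le_trans (ler_norm _))// -mulrA.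
by apply: dotp_le => i; exact: coord_le_norm.
Qed.

End lipschitz_rV.

Section envelope.
Context {R : realType} {m : nat} (Om : set 'rV[R]_m) (u : 'rV[R]_m -> R).
Context (c : 'rV[R]_m) (r a : R).

(* Minus the Legendre transform of u, centred at c, on the closure of Om. *)
Definition height (p : 'rV[R]_m) : R :=
  inf [set u x - dotp p (x - c) | x in closure Om].

Definition plane p x := height p + dotp p (x - c).

Definition slopes : set 'rV[R]_m := [set p | forall i, `|p 0 i| < a].

(** Restricting the slopes to a bounded cube makes this finite and Lipschitz on the whole space, as
    the second difference estimate requires. *)
Definition envelope (x : 'rV[R]_m) : R := sup [set plane p x | p in slopes].

Definition section_at (h : R) p : set 'rV[R]_m :=
  [set x | envelope x < plane p x + h].

Definition slopes_at (h : R) x : set 'rV[R]_m :=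
  [set p | slopes p /\ envelope x < plane p x + h].

Hypothesis Om0 : Om !=set0.
Hypothesis cOm : compact (closure Om).
Hypothesis cu : {within closure Om, continuous u}.
Hypothesis Om_r : forall x, closure Om x -> forall i, `|x 0 i - c 0 i| <= r.
Hypothesis a0 : 0 < a.

Let slope_min p : exists2 x, closure Om x &
  forall y, closure Om y -> u x - dotp p (x - c) <= u y - dotp p (y - c).
Proof.
have cF : {within closure Om, continuous (fun x : 'rV[R]_m => u x - dotp p (x - c))}.
  move=> y; apply: (continuousB (cu (x := y))).
  exact: (continuous_subspaceT (@continuous_dotpB _ _ p c) (x := y)).
have [|x xO xmin] := EVT_min_rV _ cOm cF.
  by have [x Ox] := Om0; exists x; exact: subset_closure.
by rewrite inE in xO; exists x => // y Oy; apply: xmin; rewrite inE.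
Qed.

Lemma plane_le p x : closure Om x -> plane p x <= u x.
Proof.
move=> Ox; rewrite /plane -lerBrDr; apply: ge_inf; last by exists x.
have [z Oz zmin] := slope_min p.
by exists (u z - dotp p (z - c)) => _ [t Ot <-]; exact: zmin.
Qed.

(** By compactness the infimum is a minimum. For p in [slopes] the minimiser is a contact point,
    since [plane p x <= envelope x <= u x] there. *)
Lemma height_attained p : exists2 x, closure Om x & u x = plane p x.
Proof.
have [x Ox xmin] := slope_min p; exists x => //.
apply/eqP; rewrite eq_le plane_le// andbT /plane -lerBlDr.
apply: lb_le_inf; first by exists (u x - dotp p (x - c)), x.
by move=> _ [y Oy <-]; exact: xmin.
Qed.

Lemma height_lipschitz p q : height p - height q <= m%:R * r * `|p - q|.
Proof.
have [x Ox ux] := height_attained q.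
have := plane_le p Ox; rewrite ux /plane => h.
have : `|dotp (q - p) (x - c)| <= m%:R * (`|p - q| * r).
  apply: dotp_le => i; first by rewrite distrC coord_le_norm.
  by have := Om_r Ox i; rewrite !mxE.
move=> /(le_trans (ler_norm _)); rewrite dotpBl mulrCA mulrC.
move: h; set A := height p; set B := height q; set C := dotp p _; set D := dotp q _.
by rewrite mulrAC; lra.
Qed.

(** The height is an infimum of functions affine in p. Its concavity is what makes [slopes_at]
    convex. *)
Lemma height_concave p q (s t : R) : 0 <= s -> 0 <= t -> s + t = 1 ->
  s * height p + t * height q <= height (s *: p + t *: q).
Proof.
move=> s0 t0 st; have [x Ox ux] := height_attained (s *: p + t *: q).
have := plane_le p Ox; have := plane_le q Ox; rewrite ux.
rewrite /plane dotpDl !dotpZl; set A := height p; set B := height q.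
set C := dotp p _; set D := dotp q _; set E := height _ => hq hp.
have : s * (A + C) + t * (B + D) <= (s + t) * (E + (s * C + t * D)).
  by rewrite mulrDl lerD// ler_wpM2l.
by rewrite st; lra.
Qed.

Lemma slopes_norm p : slopes p -> `|p| <= a.
Proof. by move=> pa; apply: norm_le_coord => [|i]; rewrite ltW// pa. Qed.

Lemma slopes0 : slopes 0. Proof. by move=> i; rewrite mxE normr0. Qed.

Lemma plane_lipschitz p x y : slopes p -> plane p x - plane p y <= m%:R * a * `|x - y|.
Proof.
move=> pa; rewrite /plane opprD addrACA subrr add0r -dotpBr opprB addrA subrK.
rewrite (le_trans (ler_norm _))// -mulrA dotp_le// => i; first by rewrite ltW// pa.
exact: coord_le_norm.
Qed.

Lemma has_sup_planes x : has_sup [set plane p x | p in slopes].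
Proof.
split; first by exists (plane 0 x), 0 => //; exact: slopes0.
have [z Oz _] := height_attained 0.
exists (u z + m%:R * a * `|x - z|) => _ [p pa <-].
have := plane_le p Oz; have := plane_lipschitz x z pa; lra.
Qed.

Lemma plane_le_envelope p x : slopes p -> plane p x <= envelope x.
Proof. by move=> pa; apply: sup_upper_bound; [exact: has_sup_planes|exists p]. Qed.

Lemma envelope_le x B : (forall p, slopes p -> plane p x <= B) -> envelope x <= B.
Proof.
move=> h; apply: ge_sup; first by exists (plane 0 x), 0 => //; exact: slopes0.
by move=> _ [p pa <-]; exact: h.
Qed.

Lemma envelope_le_u x : closure Om x -> envelope x <= u x.
Proof. by move=> Ox; apply: envelope_le => p _; exact: plane_le. Qed.

Lemma envelope_lipschitz x y : envelope x - envelope y <= m%:R * a * `|x - y|.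
Proof.
rewrite lerBlDr; apply: envelope_le => p pa.
have := plane_lipschitz x y pa; have := plane_le_envelope y pa; lra.
Qed.

Lemma envelope_convex x y (s t : R) : 0 <= s -> 0 <= t -> s + t = 1 ->
  envelope (s *: x + t *: y) <= s * envelope x + t * envelope y.
Proof.
move=> s0 t0 st; apply: envelope_le => p pa.
have -> : plane p (s *: x + t *: y) = s * plane p x + t * plane p y.
  rewrite /plane !dotpBr dotpDr !dotpZr -[height p in LHS]mul1r -[dotp p c in LHS]mul1r -st.
  ring.
by rewrite lerD// ler_wpM2l// plane_le_envelope.
Qed.

Lemma continuous_envelope : continuous envelope.
Proof. exact: lipschitz_rV_continuous envelope_lipschitz. Qed.

Lemma continuous_height : continuous height.
Proof. exact: lipschitz_rV_continuous height_lipschitz. Qed.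

Lemma open_slopes : open slopes.
Proof.
rewrite openE => p pa.
apply/nbhs_ballP; exists (\big[Num.min/a]_i (a - `|p 0 i|)) => /=.
  by apply/bigmin_gtP; split=> // i _; rewrite subr_gt0 pa.
move=> q [_ pq] i; have := pq 0 i; rewrite /ball/= => pqi.
have : `|q 0 i| <= `|p 0 i| + `|p 0 i - q 0 i|.
  by rewrite distrC -[X in `|X| <= _](subrKC (p 0 i)) ler_normD.
move=> /le_lt_trans; apply; rewrite -ltrBrDl (lt_le_trans pqi)//.
exact: bigmin_le_cond.
Qed.

Lemma open_section_at h p : open (section_at h p).
Proof.
apply: open_lt_continuous; first exact: continuous_envelope.
apply: (@lipschitz_rV_continuous _ _ _ (m%:R * `|p|)) => x y.
rewrite opprD addrACA subrr addr0 /plane opprD addrACA subrr add0r.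
rewrite -dotpBr opprB addrA subrK (le_trans (ler_norm _))// -mulrA.
by apply: dotp_le => i; exact: coord_le_norm.
Qed.

Lemma convex_section_at h p : convex_rV (section_at h p).
Proof.
move=> x y s t; rewrite /section_at/= => hx hy s0 t0 st.
rewrite (le_lt_trans (envelope_convex _ _ s0 t0 st))//.
have -> : plane p (s *: x + t *: y) + h = s * (plane p x + h) + t * (plane p y + h).
  rewrite /plane !dotpBr dotpDr !dotpZr -[height p in LHS]mul1r -[dotp p c in LHS]mul1r.
  by rewrite -[h in LHS]mul1r -st; ring.
move: s0; rewrite le_eqVlt => /orP[/eqP s0|s0].
  by move: st; rewrite -s0 add0r => ->; rewrite !mul0r !add0r !mul1r.
by rewrite ltr_leD// ?ltr_pM2l// ler_wpM2l// ltW.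
Qed.

Lemma open_slopes_at h x : open (slopes_at h x).
Proof.
apply: openI; first exact: open_slopes.
apply: open_lt_continuous; first exact: cst_continuous.
apply: (@lipschitz_rV_continuous _ _ _ (m%:R * r + m%:R * `|x - c|)) => p q.
rewrite opprD addrACA subrr addr0 /plane opprD addrACA mulrDl lerD//.
  exact: height_lipschitz.
rewrite -dotpBl (le_trans (ler_norm _))// -mulrA [_ * `|p - q|]mulrC.
by apply: dotp_le => i; exact: coord_le_norm.
Qed.

Lemma convex_slopes_at h x : convex_rV (slopes_at h x).
Proof.
move=> p q s t [pa hp] [qa hq] s0 t0 st; split.
  move=> i; rewrite !mxE (le_lt_trans (ler_normD _ _))// !normrM (ger0_norm s0) (ger0_norm t0).
  rewrite -[ltRHS]mul1r -st mulrDl.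
  move: s0; rewrite le_eqVlt => /orP[/eqP s0|s0].
    by move: st; rewrite -s0 add0r => ->; rewrite !mul0r !add0r !mul1r qa.
  by rewrite ltr_leD// ?ltr_pM2l// ler_wpM2l// ltW.
have := height_concave p q s0 t0 st.
rewrite /plane dotpDl !dotpZl => hh.
apply: (@lt_le_trans _ _ (s * (plane p x + h) + t * (plane q x + h))).
  rewrite -[ltLHS]mul1r -st mulrDl.
  move: s0 {hh}; rewrite le_eqVlt => /orP[/eqP s0|s0].
    by move: st; rewrite -s0 add0r => ->; rewrite !mul0r !add0r !mul1r.
  by rewrite ltr_leD// ?ltr_pM2l// ler_wpM2l// ltW.
rewrite /plane -[X in _ <= _ + X]mul1r -[in leRHS]st.
move: hh; set A := height p; set B := height q; set E := height _.
set C := dotp p _; set D := dotp q _; lra.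
Qed.

Lemma bounded_slopes_at h x p : slopes_at h x p -> `|p| <= a.
Proof. by move=> [/slopes_norm]. Qed.

End envelope.

(** The first factor is the outer volume ratio of [convex_frames]; the second is (lam h)^(-n) for
    the coefficient lam of the quadratic in [slopes_at_measure]. *)
Definition slopes_const (R : realType) (n : nat) : R :=
  (4 * 3 ^+ (n + n)) ^+ (n + n) * (8 * n%:R * (2 * (n + n)%:R) ^+ 2) ^+ n.

(** The first factor is the inner volume ratio of [convex_frames]; the second is (lam / h)^n for the
    coefficient lam in [section_at_measure]. *)
Definition section_const (R : realType) (n : nat) : R :=
  (n + n)%:R^-1 ^+ (n + n) * (2 * n%:R * (2 * 3 ^+ (n + n)) ^+ 2)^-1 ^+ n.

Lemma slopes_const_ge0 (R : realType) (n : nat) : 0 <= slopes_const R n.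
Proof. by rewrite /slopes_const !mulr_ge0// ?exprn_ge0 ?mulr_ge0 ?exprn_ge0. Qed.

Lemma section_const_gt0 (R : realType) (n : nat) :
  (0 < n)%N -> 0 < section_const R n.
Proof.
move=> n0; have nR : 0 < n%:R :> R by rewrite ltr0n.
have mR : 0 < (n + n)%:R :> R by rewrite ltr0n addn_gt0 n0.
by rewrite /section_const !(mulr_gt0, exprn_gt0, invr_gt0).
Qed.

(** * Volume of the sections and of the sets of slopes *)

Section envelope_measure.
Context {R : realType} {n : nat} (Om : set 'rV[R]_(n + n)).
Context (f u : 'rV[R]_(n + n) -> R) (c : 'rV[R]_(n + n)) (r a : R).
Hypothesis n0 : (0 < n)%N.
Hypothesis oOm : open Om.
Hypothesis Om0 : Om !=set0.
Hypothesis cOm : compact (closure Om).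
Hypothesis cu : {within closure Om, continuous u}.
Hypothesis visc : viscosity_supersolution Om f u.
Hypothesis u_ge0 : forall x, boundary Om x -> 0 <= u x.
Hypothesis Om_r : forall x, closure Om x -> forall i, `|x 0 i - c 0 i| <= r.
Hypothesis a0 : 0 < a.

Local Notation m := (n + n)%N.
Local Notation mu := (@lebesgue_rV R m).
Local Notation pln := (plane Om u c).
Local Notation env := (envelope Om u c a).
Local Notation sec := (section_at Om u c a).
Local Notation slp := (slopes_at Om u c a).

Let pln_le p y : closure Om y -> pln p y <= u y.
Proof. exact: plane_le. Qed.

Let pln_le_env p y : slopes a p -> pln p y <= env y.
Proof. exact: plane_le_envelope. Qed.

Let env_le_u y : closure Om y -> env y <= u y.
Proof. exact: envelope_le_u. Qed.

Lemma planeE p x y : pln p y = pln p x + dotp p (y - x).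
Proof. by rewrite /plane !dotpBr; ring. Qed.

(** Let L be the affine function of slope z with value [env x - h] at x. The slopes z + t w_j with
    |t| <= tau lie in [slp h x], so their planes are below u on the closure of Om and above
    [env x - h] at x; hence u - L >= tau |<w_j, y - x>|. Where u - L <= 2h all these forms are
    small, so a quadratic built from them fits under u. Its complex determinant is at least D, which
    is comparable to the volume of [slp h x]. *)
Lemma slopes_at_measure (h : R) x : 0 < h -> slp h x !=set0 ->
  (forall p y, slopes a p -> closure Om y -> pln p y + 2 * h < 0) ->
  exists p y, [/\ slp h x p, Om y, u y < pln p y + 2 * h &
    (mu (slp h x) <= (slopes_const R n * h ^+ n * f y)%:E)%E].
Proof.
move=> h0 D0 neg.
have m0 : (0 < m)%N by rewrite addn_gt0 n0.
have nR : 0 < n%:R :> R by rewrite ltr0n.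
have mR : 0 < m%:R :> R by rewrite ltr0n.
have [z [D [w [_ [Dgt0 _ muD [wD Dw] _]]]]] :=
  convex_frames n0 (open_slopes_at (h := h) (x := x) Om0 cOm cu Om_r a0) D0
    (bounded_slopes_at a0 (h := h) (x := x))
    (convex_slopes_at Om0 cOm cu (h := h) (x := x)).
set tau : R := (2 * m%:R)^-1 in wD.
have tau0 : 0 < tau by rewrite invr_gt0 mulr_gt0.
have Dz : slp h x z.
  by have := wD (Ordinal n0) 0; rewrite scale0r addr0 normr0; apply; exact: ltW.
(* Chosen so that n * lam * (2h / tau)^2 = h / 2, the truncation level. The contact point of slope z
   has gap at most h, and h + h / 2 < 2h. *)
pose lam : R := tau ^+ 2 / (8 * n%:R * h).
have lam0 : 0 < lam by rewrite divr_gt0 ?exprn_gt0// !mulr_gt0.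
pose kappa := env x - h - dotp z x.
have kE y : kappa + dotp z y = env x - h + dotp z (y - x).
  by rewrite dotpBr /kappa; ring.
have [x0 Ox0 ux0] := height_attained c Om0 cOm cu z.
have [y [Oy uy fy]] : exists y, [/\ Om y, u y - (kappa + dotp z y) <= h + h / 2 &
    lam ^+ n * sqnormC (\det (complexify w)) <= f y].
  apply: (@touching_minimum _ _ _ _ _ oOm cOm cu visc u_ge0 w z x x0 kappa lam (2 * h)) => //.
  - exact: ltW.
  - by rewrite divr_ge0// ltW.
  - rewrite ux0 kE (planeE z x x0); have := pln_le_env x Dz.1.
    by set A := dotp _ _; lra.
  - move=> y Oy uy.
    have wj j : `|dotp (w j) (y - x)| <= 2 * h / tau.
      rewrite ler_pdivlMr// -[X in _ * X](gtr0_norm tau0) -normrM mulrC -dotpZl.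
      have key t : `|t| <= tau -> dotp (t *: w j) (y - x) <= 2 * h.
        move=> /(wD j)[st ht]; have := pln_le (z + t *: w j) Oy.
        rewrite (planeE _ x) dotpDl; move: uy ht; rewrite kE.
        by set A := dotp z _; set B := dotp (_ *: _) _; set E := pln _ _; lra.
      rewrite ler_norml key ?gtr0_norm// andbT.
      have := key (- tau); rewrite normrN gtr0_norm// lexx scaleNr => /(_ isT).
      by rewrite dotpNl lerNl.
    rewrite (@le_trans _ _ (lam * (n%:R * (2 * h / tau) ^+ 2)))//.
      rewrite ler_pM2l// mulr_natl -[X in _ *+ X]card_ord -sumr_const.
      apply: ler_sum => j _; rewrite -real_normK ?num_real//.
      by rewrite lerXn2r// nnegrE// divr_ge0// ltW// mulr_gt0.
    rewrite le_eqVlt; apply/orP; left; apply/eqP.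
    rewrite /lam; field; rewrite !gt_eqF//.
  - lra.
  - move=> y Oy; rewrite kE; have := neg _ _ Dz.1 Oy; rewrite (planeE z x).
    by have := Dz.2; set A := dotp _ _; lra.
exists z, y; split=> //.
  move: uy; rewrite kE (planeE z x); have := Dz.2.
  by set A := dotp _ _; lra.
rewrite (le_trans muD)// lee_fin /slopes_const -!mulrA ler_wpM2l ?exprn_ge0//
  ?mulr_ge0// ?exprn_ge0//.
have : lam ^+ n * D <= f y by rewrite (le_trans _ fy)// ler_pM2l// exprn_gt0.
rewrite -ler_pdivlMl ?exprn_gt0// => /le_trans; apply.
rewrite -exprVn mulrA -exprMn_comm; last by rewrite /GRing.comm mulrC.
rewrite le_eqVlt; apply/orP; left; apply/eqP; congr (_ ^+ _ * _).
by rewrite /lam /tau; field; rewrite !gt_eqF ?addr_gt0.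
Qed.

(** Dual to [slopes_at_measure]. The set where u - pln p < h lies in the section, on which the forms
    w_j are bounded by C1, so a quadratic built from them fits under u above the plane of slope p.
    Its determinant is at least 1 / D while the section has volume at least a constant times D, and
    D drops out of the product. *)
Lemma section_at_measure (h B : R) p : 0 < h -> slopes a p ->
  (forall x, sec h p x -> `|x| <= B) ->
  (forall y, closure Om y -> pln p y + h < 0) ->
  exists y, [/\ Om y, sec h p y &
    ((section_const R n * h ^+ n)%:E <= (f y)%:E * mu (sec h p))%E].
Proof.
move=> h0 pa SB neg.
have m0 : (0 < m)%N by rewrite addn_gt0 n0.
have nR : 0 < n%:R :> R by rewrite ltr0n.
have mR : 0 < m%:R :> R by rewrite ltr0n.
have [x0 Ox0 ux0] := height_attained c Om0 cOm cu p.
have Sx0 : sec h p x0.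
  rewrite /section_at /= -ux0 (le_lt_trans (env_le_u Ox0))//.
  by rewrite ltrDl.
have [z [D [_ [w [Dgt0 Dmu _ _ [wS Dw]]]]]] :=
  convex_frames n0 (open_section_at (c := c) (h := h) (p := p) Om0 cOm cu a0)
    (ex_intro _ x0 Sx0) SB (convex_section_at Om0 cOm cu a0 (h := h) (p := p)).
set C1 : R := 2 * 3 ^+ m in wS.
have C10 : 0 < C1 by rewrite mulr_gt0 ?exprn_gt0.
(* Chosen so that n * lam * C1 ^+ 2 = h / 2. The initial gap is 0, as the plane of slope p meets u
   at x0, and h / 2 < 3h / 4 < h. *)
pose lam : R := h / (2 * n%:R * C1 ^+ 2).
have lam0 : 0 < lam by rewrite divr_gt0 ?mulr_gt0 ?exprn_gt0.
have in_section y : closure Om y -> u y - pln p y < h -> sec h p y.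
  move=> Oy uy; rewrite /section_at/=.
  by have := env_le_u Oy; lra.
have kE y : height Om u c p - dotp p c + dotp p y = pln p y.
  by rewrite /plane dotpBr; ring.
have [y [Oy uy fy]] : exists y, [/\ Om y,
    u y - (height Om u c p - dotp p c + dotp p y) <= 0 + h / 2 &
    lam ^+ n * sqnormC (\det (complexify w)) <= f y].
  apply: (@touching_minimum _ _ _ _ _ oOm cOm cu visc u_ge0 w p z x0 _ lam (3 * h / 4)) => //.
  - exact: ltW.
  - by rewrite divr_ge0// ltW.
  - by rewrite kE ux0 subrr.
  - move=> y Oy; rewrite kE => uy.
    have Sy : sec h p y by apply: in_section => //; lra.
    rewrite (@le_trans _ _ (lam * (n%:R * C1 ^+ 2)))//.
      rewrite ler_pM2l// mulr_natl -[X in _ *+ X]card_ord -sumr_const.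
      apply: ler_sum => j _; rewrite -real_normK ?num_real//.
      by rewrite lerXn2r// ?nnegrE ?wS// ltW.
    rewrite le_eqVlt; apply/orP; left; apply/eqP.
    by rewrite /lam; field; rewrite !gt_eqF.
  - lra.
  - by move=> y Oy; rewrite kE; have := neg y Oy; lra.
exists y; split=> //.
  by apply: in_section; [exact: subset_closure|move: uy; rewrite kE; lra].
have lamD : lam ^+ n * D^-1 <= f y by rewrite (le_trans _ fy)// ler_pM2l// exprn_gt0.
have fy0 : 0 <= f y by rewrite (le_trans _ lamD)// mulr_ge0 ?exprn_ge0 ?invr_ge0// ltW.
apply: (@le_trans _ _ ((f y)%:E * (m%:R^-1 ^+ m * D)%:E)%E); last first.
  by apply: lee_wpmul2l => //; rewrite lee_fin.
rewrite -EFinM lee_fin mulrCA /section_const -[leLHS]mulrA.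
apply: ler_wpM2l; first by rewrite exprn_ge0// invr_ge0.
rewrite -exprMn mulrC; move: lamD; rewrite ler_pdivrMr// => /le_trans->.
Qed.

End envelope_measure.

(** * Second differences *)

Section second_difference.
Context {R : realType} {m : nat}.
Local Notation mu := (@lebesgue_rV R m).

Lemma measurable_translation (v : 'rV[R]_m) :
  measurable_fun [set: 'rV[R]_m] (fun x => x + v).
Proof.
apply: measurable_fun_rVP => i; under eq_fun do rewrite mxE.
by apply: measurable_funD => //; exact: measurable_coord_rV.
Qed.

Lemma ge0_integral_translation (v : 'rV[R]_m) (g : 'rV[R]_m -> \bar R) :
  measurable_fun setT g -> (forall x, (0 <= g x)%E) ->
  (\int[mu]_x g (x + v)%R = \int[mu]_x g x)%E.
Proof.
move=> mg g0.
have := @ge0_integral_pushforward _ _ _ _ R _ (measurable_translation v) mu setT g measurableT mg.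
rewrite preimage_setT => /(_ (fun x _ => g0 x)) <-.
apply: eq_measure_integral; first exact: measurable_translation.
by move=> mv A mA _; exact: lebesgue_rV_translation.
Qed.

Definition second_difference (F : 'rV[R]_m -> R) (s : R) (k : 'I_m) x : R :=
  F (x + s *: delta_mx 0 k) + F (x - s *: delta_mx 0 k) - 2 * F x.

Definition cube (A : R) : set 'rV[R]_m := box (fun=> `]-A, A[%classic).

Lemma measurable_cube A : measurable (cube A).
Proof. by apply: measurable_box => i; exact: measurable_itv. Qed.

Lemma lebesgue_rV_cube A : 0 <= A -> mu (cube A) = ((2 * A) ^+ m)%:E.
Proof.
move=> A0; rewrite lebesgue_rV_box => [|i]; last exact: measurable_itv.
rewrite (eq_bigr (fun=> (2 * A)%:E)) => [|i _].
  by rewrite -(big_morph _ EFinM (erefl 1%:E)) prodr_const card_ord.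
rewrite lebesgue_measure_itv/= lte_fin; case: ltP => h.
  by rewrite -EFinD; congr EFin; ring.
by congr EFin; lra.
Qed.

Lemma lebesgue_rV_slab A s k : 0 <= A -> 0 < s ->
  (mu [set x | cube A x /\ ~ cube A (x + s *: delta_mx 0 k)%R] <=
   (s * (2 * A) ^+ m.-1)%:E)%E.
Proof.
move=> A0 s0.
pose B i := if i == k then `[A - s, A]%classic else `]-A, A[%classic.
have mB i : measurable (B i) by rewrite /B; case: ifP => _; exact: measurable_itv.
apply: (@le_trans _ _ (mu (box B))).
  apply: le_measure; rewrite ?inE.
  - apply: measurableI; first exact: measurable_cube.
    apply: measurableC; rewrite -[X in measurable X]setTI.
    by apply: measurable_translation => //; exact: measurable_cube.
  - exact: measurable_box.
  - move=> x [Qx nQx] i; rewrite /B; case: eqP => [->|_]; last exact: Qx.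
    rewrite /= in_itv/=; have := Qx k; rewrite /= in_itv/= => /andP[x1 x2].
    rewrite (ltW x2) andbT leNgt; apply/negP => xA; apply: nQx => j.
    rewrite /= in_itv/= !mxE eqxx/=; have := Qx j; rewrite /= in_itv/= => /andP[y1 y2].
    case: (j =P k) => [->|_] /=; last by rewrite mulr0 addr0 y1.
    by rewrite mulr1; apply/andP; split; lra.
rewrite lebesgue_rV_box// (bigD1 k)//= /B eqxx lebesgue_measure_itv/= lte_fin ltrBlDr ltrDl s0.
rewrite (eq_bigr (fun=> (2 * A)%:E)) => [|i /negbTE ->].
  rewrite -(big_morph _ EFinM (erefl 1%:E)) prodr_const -EFinD -EFinM lee_fin.
  rewrite opprB addrCA subrr addr0 cardC1 card_ord.
  by [].
rewrite lebesgue_measure_itv/= lte_fin; case: ltP => h.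
  by rewrite -EFinD; congr EFin; ring.
by congr EFin; lra.
Qed.

Lemma measurable_second_difference_set (F : 'rV[R]_m -> R) (A b s : R) k :
  continuous F -> measurable [set x | cube A x /\ b <= second_difference F s k x].
Proof.
move=> /continuous_measurable_rV mF; apply: measurableI; first exact: measurable_cube.
rewrite -[X in measurable X]setTI; apply: measurable_fun_le => //.
have mFv (w : 'rV[R]_m) : measurable_fun setT (fun x : 'rV[R]_m => F (x + w)).
  exact: (measurableT_comp mF (measurable_translation w)).
by apply: measurable_funB; [exact: measurable_funD|exact: measurable_funM].
Qed.

(** The second difference is D(x) - D(x - v) for the first difference D, so its integral over the
    cube telescopes to a boundary term: at most the integral of D over a slab of width s. Adding L s
    to the first difference places D between 0 and 2 L s. Chebyshev's inequality concludes, and the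
    bound is of order s for fixed rho. *)
Lemma measure_second_difference (F : 'rV[R]_m -> R) (L A s rho : R) (k : 'I_m) :
  (forall x y, F x - F y <= L * `|x - y|) ->
  (forall x, 0 <= second_difference F s k x) ->
  0 <= A -> 0 < s -> 0 < rho ->
  (mu [set x | cube A x /\ (rho * s <= second_difference F s k x)%R] <=
   (2 * L / rho * (s * (2 * A) ^+ m.-1))%:E)%E.
Proof.
move=> FL F2 A0 s0 rho0.
set Z := [set x | _]; set v : 'rV[R]_m := s *: delta_mx 0 k in Z F2 *.
have cF := lipschitz_rV_continuous FL.
have mF := continuous_measurable_rV cF.
have mFv (w : 'rV[R]_m) : measurable_fun setT (fun x : 'rV[R]_m => F (x + w)).
  exact: (measurableT_comp mF (measurable_translation w)).
have vn : `|v| = s.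
  rewrite /v normrZ gtr0_norm// [X in _ * X](_ : _ = 1) ?mulr1//.
  apply/eqP; rewrite eq_le; apply/andP; split.
    by apply: norm_le_coord => // i; rewrite mxE; case: (_ && _); rewrite ?normr1 ?normr0.
  by have := coord_le_norm (delta_mx 0 k : 'rV[R]_m) k; rewrite mxE !eqxx normr1.
have L0 : 0 <= L.
  have := FL v 0; have := FL 0 v; rewrite subr0 sub0r normrN vn => h1 h2.
  by rewrite -(pmulr_rge0 _ s0); lra.
pose D (x : 'rV[R]_m) := F (x + v) - F x + L * s.
have mD : measurable_fun setT D.
  by apply: measurable_funD => //; apply: measurable_funB.
have D0 x : 0 <= D x.
  by have := FL x (x + v); rewrite opprD addrA subrr sub0r normrN vn /D; lra.
have D2 x : D x <= 2 * L * s.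
  by have := FL (x + v) x; rewrite addrAC subrr add0r vn /D; lra.
have DE x : second_difference F s k x = D x - D (x - v).
  by rewrite /second_difference -/v /D subrK; ring.
pose Q := cube A; pose Qv := [set x : 'rV[R]_m | Q (x + v)].
have mQ : measurable Q by exact: measurable_cube.
have mQv : measurable Qv.
  by rewrite -[X in measurable X]setTI; exact: measurable_translation.
have mZ : measurable Z by exact: measurable_second_difference_set.
pose S := [set x : 'rV[R]_m | Q x /\ ~ Q (x + v)].
have mS : measurable S by apply: measurableI => //; exact: measurableC.
have mDv (w : 'rV[R]_m) : measurable_fun setT (fun x : 'rV[R]_m => D (x + w)).
  exact: (measurableT_comp mD (measurable_translation w)).
have mind (B : set 'rV[R]_m) (g : 'rV[R]_m -> R) : measurable B -> measurable_fun setT g ->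
    measurable_fun setT (fun x => ((\1_B x * g x)%R)%:E).
  by move=> mB mg; apply/measurable_EFinP; apply: measurable_funM.
pose I := (\int[mu]_x ((\1_Qv x * D x)%R)%:E)%E.
have IE : (\int[mu]_x ((\1_Q x * D (x - v))%R)%:E)%E = I.
  rewrite -(@ge0_integral_translation v).
  - by apply: eq_integral => x _; rewrite addrK.
  - exact: mind.
  - by move=> x; rewrite lee_fin mulr_ge0.
have rs0 : 0 <= rho * s by apply: mulr_ge0; exact: ltW.
have Ls0 : 0 <= 2 * L * s by apply: mulr_ge0; [apply: mulr_ge0|exact: ltW].
have Ifin : (I < +oo)%E.
  apply: (@le_lt_trans _ _ (\int[mu]_x ((2 * L * s)%:E * (\1_Qv x)%:E))%E).
    apply: ge0_le_integral => //.
    - by move=> x _; rewrite lee_fin mulr_ge0.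
    - exact: mind.
    - by apply/measurable_EFinP; apply: measurable_funM.
    - by move=> x _; rewrite -EFinM lee_fin mulrC ler_wpM2r.
  rewrite ge0_integralZl//; last exact/measurable_EFinP.
  rewrite integral_indic// setIT.
  rewrite [X in (_ * X)%E](_ : _ = ((2 * A) ^+ m)%:E).
    by rewrite -EFinM ltry.
  by rewrite -(lebesgue_rV_cube A0); exact: lebesgue_rV_translation.
(* The telescoping is stated additively, so that only nonnegative integrals occur; the finite term I
   is cancelled afterwards. *)
have key : ((rho * s)%:E * mu Z + I <= I + (2 * L * s)%:E * mu S)%E.
  have intc (B : set 'rV[R]_m) (b : R) : measurable B -> 0 <= b ->
      (b%:E * mu B = \int[mu]_x ((b * \1_B x)%R)%:E)%E.
    move=> mB b0; under eq_integral do rewrite EFinM.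
    rewrite ge0_integralZl//; last exact/measurable_EFinP.
    by rewrite integral_indic// setIT.
  rewrite !intc// -[X in (_ + X <= _)%E]IE -!ge0_integralD//; first last.
  - exact: mind.
  - by move=> x _; rewrite lee_fin mulr_ge0.
  - by apply/measurable_EFinP; apply: measurable_funM.
  - by move=> x _; rewrite lee_fin mulr_ge0.
  - by apply/measurable_EFinP; apply: measurable_funM.
  - by move=> x _; rewrite lee_fin mulr_ge0.
  - exact: mind.
  - by move=> x _; rewrite lee_fin mulr_ge0.
  apply: ge0_le_integral => //.
  - by move=> x _; rewrite -EFinD lee_fin addr_ge0// mulr_ge0.
  - by apply: emeasurable_funD; [apply/measurable_EFinP; apply: measurable_funM|exact: mind].
  - by apply: emeasurable_funD; [exact: mind|apply/measurable_EFinP; apply: measurable_funM].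
  move=> x _; rewrite -!EFinD lee_fin !indicE.
  have Dx := D0 x; have D2x := D2 x; have := F2 x; rewrite DE => F2x.
  have Dvx := D0 (x - v).
  have [xQ|xQ] := boolP (x \in Q); last first.
    rewrite [x \in Z](_ : _ = false).
      by rewrite mul0r mulr0 addr0 addr_ge0// mulr_ge0.
    by apply/negbTE; apply: contra xQ; rewrite !inE => -[].
  have lhs : rho * s * (x \in Z)%:R + D (x - v) <= D x.
    have [|_] := boolP (x \in Z); last by rewrite mulr0 add0r; lra.
    by rewrite inE => -[_]; rewrite DE mulr1; lra.
  rewrite mul1r (le_trans lhs)//.
  have [xQv|xQv] := boolP (x \in Qv).
    by rewrite mul1r lerDl mulr_ge0.
  rewrite mul0r add0r (_ : x \in S) ?mulr1//.
  by move: xQ xQv; rewrite !inE notin_setE => ? ?; split.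
have {}key : ((rho * s)%:E * mu Z <= (2 * L * s)%:E * mu S)%E.
  move: key; rewrite addeC leeD2rE// ge0_fin_numE//.
  by apply: integral_ge0 => x _; rewrite lee_fin mulr_ge0.
have mS_le := lebesgue_rV_slab k A0 s0.
have : ((rho * s)%:E * mu Z <= (2 * L * s)%:E * (s * (2 * A) ^+ m.-1)%:E)%E.
  by rewrite (le_trans key)// lee_wpmul2l// lee_fin.
rewrite -EFinM muleC -lee_pdivlMr ?mulr_gt0// -EFinM => /le_trans; apply.
rewrite lee_fin le_eqVlt; apply/orP; left; apply/eqP.
by field; rewrite !gt_eqF.
Qed.

End second_difference.

(** * Slopes and points with large sections *)

Section bad_sets.
Context {R : realType} {n : nat} (Om : set 'rV[R]_(n + n)).
Context (u : 'rV[R]_(n + n) -> R) (c : 'rV[R]_(n + n)) (r a : R).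
Hypothesis Om0 : Om !=set0.
Hypothesis cOm : compact (closure Om).
Hypothesis cu : {within closure Om, continuous u}.
Hypothesis Om_r : forall x, closure Om x -> forall i, `|x 0 i - c 0 i| <= r.
Hypothesis a0 : 0 < a.

Local Notation m := (n + n)%N.
Local Notation mu := (@lebesgue_rV R m).
Local Notation pln := (plane Om u c).
Local Notation env := (envelope Om u c a).
Local Notation sec := (section_at Om u c a).
Local Notation slp := (slopes_at Om u c a).
Local Notation ht := (height Om u c).

Let pln_le_env p y : slopes a p -> pln p y <= env y.
Proof. exact: plane_le_envelope. Qed.

(** The planes of slopes p + s e_k at x and p - s e_k at x' lie below the envelope, which at both
    points is within h of the plane of slope p. Adding the two inequalities, a section wide in
    direction k forces a large second difference of the height. *)
Lemma coord_diff_section h s k p x x' :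
  slopes a (p + s *: delta_mx 0 k) -> slopes a (p - s *: delta_mx 0 k) ->
  sec h p x -> sec h p x' ->
  s * (x 0 k - x' 0 k) < second_difference (fun q => - ht q) s k p + 2 * h.
Proof.
move=> pa1 pa2; rewrite /section_at/= => px px'.
have := le_lt_trans (pln_le_env x pa1) px.
have := le_lt_trans (pln_le_env x' pa2) px'.
rewrite /plane !dotpBl !dotpDl !dotpZl !dotp_deltal !mxE /second_difference.
move: (ht (p + s *: _)) (ht (p - s *: _)) (ht p) (dotp p (x - c)) (dotp p (x' - c)).
move: (x 0 k) (x' 0 k) (c 0 k) => x1 x2 x3 A B C D E.
by rewrite !mulrBr; move: (s * x1) (s * x2) (s * x3) => ? ? ?; lra.
Qed.

(** The roles of points and slopes are exchanged: the planes of slopes p and q are evaluated at x +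
    s e_k and x - s e_k. *)
Lemma coord_diff_slopes h s k x p q :
  slp h x p -> slp h x q ->
  s * (p 0 k - q 0 k) < second_difference env s k x + 2 * h.
Proof.
move=> [pa hp] [qa hq].
have := pln_le_env (x + s *: delta_mx 0 k) pa.
have := pln_le_env (x - s *: delta_mx 0 k) qa.
have -> : pln p (x + s *: delta_mx 0 k) = pln p x + s * p 0 k.
  by rewrite (planeE _ _ _ _ x) [x + _ - x]addrAC subrr add0r dotpZr dotp_delta.
have -> : pln q (x - s *: delta_mx 0 k) = pln q x - s * q 0 k.
  by rewrite (planeE _ _ _ _ x) [x - _ - x]addrAC subrr add0r dotpNr dotpZr dotp_delta.
rewrite /second_difference.
move: (env (x + s *: _)) (env (x - s *: _)) (env x) (pln p x) (pln q x) hp hq.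
by rewrite !mulrBr; move: (s * p 0 k) (s * q 0 k) => *; lra.
Qed.

Definition bad_slopes (b del s : R) : set 'rV[R]_m :=
  \big[setU/set0]_(k < m)
    [set p | cube b p /\ del * s <= second_difference (fun q => - ht q) s k p].

Definition bad_points (b rho s : R) : set 'rV[R]_m :=
  \big[setU/set0]_(k < m)
    [set x | cube b x /\ rho * s <= second_difference env s k x].

Let oppht_lipschitz p q : - ht p - - ht q <= m%:R * r * `|p - q|.
Proof.
have := height_lipschitz Om0 cOm cu Om_r q p; rewrite distrC.
by move: (ht p) (ht q) => A B; rewrite opprK addrC.
Qed.

Let cont_oppht : continuous (fun q => - ht q).
Proof. exact: lipschitz_rV_continuous oppht_lipschitz. Qed.

Let cont_env : continuous env.
Proof. exact: continuous_envelope. Qed.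

Let midpoint_symm (p v : 'rV[R]_m) : 2^-1 *: (p + v) + 2^-1 *: (p - v) = p.
Proof.
rewrite -scalerDr addrACA subrr addr0 -mulr2n -(scaler_nat 2 p) scalerA mulVf ?scale1r//.
Qed.

Lemma second_difference_height_ge0 s k p :
  0 <= second_difference (fun q => - ht q) s k p.
Proof.
rewrite /second_difference; set v := s *: _.
have := @height_concave _ _ _ _ c Om0 cOm cu (p + v) (p - v) 2^-1 2^-1.
rewrite midpoint_symm invr_ge0 ler0n (_ : 2^-1 + 2^-1 = 1); last by field.
move/(_ isT isT erefl).
by move: (ht (p + v)) (ht (p - v)) (ht p) => *; lra.
Qed.

Lemma second_difference_envelope_ge0 s k x : 0 <= second_difference env s k x.
Proof.
rewrite /second_difference; set v := s *: _.
have := @envelope_convex _ _ _ _ c a Om0 cOm cu a0 (x + v) (x - v) 2^-1 2^-1.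
rewrite midpoint_symm invr_ge0 ler0n (_ : 2^-1 + 2^-1 = 1); last by field.
move/(_ isT isT erefl).
by move: (env (x + v)) (env (x - v)) (env x) => *; lra.
Qed.

Lemma measurable_bad_slopes b del s : measurable (bad_slopes b del s).
Proof.
by apply: bigsetU_measurable => k _; exact: measurable_second_difference_set.
Qed.

Lemma measurable_bad_points b rho s : measurable (bad_points b rho s).
Proof.
by apply: bigsetU_measurable => k _; exact: measurable_second_difference_set.
Qed.

Let boole (B : 'I_m -> set 'rV[R]_m) (K : R) : (forall k, measurable (B k)) ->
  (forall k, (mu (B k) <= K%:E)%E) ->
  (mu (\big[setU/set0]_(k < m) B k) <= (m%:R * K)%:E)%E.
Proof.
move=> mB BK.
pose B' i := if insub i is Some k then B k else set0.
rewrite (eq_bigr (fun k : 'I_m => B' k)); last by move=> k _; rewrite /B' valK.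
apply: (@le_trans _ _ (\sum_(i < m) mu (B' i))%E).
  apply: Boole_inequality => i im; rewrite /B'; case: insubP => // *; exact: mB.
rewrite mulr_natl -[X in _ *+ X]card_ord -sumr_const -sumEFin.
by apply: lee_sum => i _; rewrite /B' valK.
Qed.

Lemma bad_slopes_measure b del s : 0 <= b -> 0 < s -> 0 < del ->
  (mu (bad_slopes b del s) <=
   (m%:R * (2 * (m%:R * r) / del * (s * (2 * b) ^+ m.-1)))%:E)%E.
Proof.
move=> b0 s0 d0; apply: boole => k; first exact: measurable_second_difference_set.
apply: measure_second_difference => //; last exact: second_difference_height_ge0.
Qed.

Lemma bad_points_measure b rho s : 0 <= b -> 0 < s -> 0 < rho ->
  (mu (bad_points b rho s) <=
   (m%:R * (2 * (m%:R * a) / rho * (s * (2 * b) ^+ m.-1)))%:E)%E.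
Proof.
move=> b0 s0 d0; apply: boole => k; first exact: measurable_second_difference_set.
apply: measure_second_difference => //; last exact: second_difference_envelope_ge0.
by move=> x y; exact: envelope_lipschitz.
Qed.

End bad_sets.

(** * Integrating over slopes and points *)

Section tonelli.
Context {R : realType} {n : nat} (Om : set 'rV[R]_(n + n)).
Context (f u : 'rV[R]_(n + n) -> R) (c : 'rV[R]_(n + n)) (r a : R).
Hypothesis n0 : (0 < n)%N.
Hypothesis oOm : open Om.
Hypothesis Om0 : Om !=set0.
Hypothesis cOm : compact (closure Om).
Hypothesis cu : {within closure Om, continuous u}.
Hypothesis visc : viscosity_supersolution Om f u.
Hypothesis u_ge0 : forall x, boundary Om x -> 0 <= u x.
Hypothesis r0 : 0 < r.
Hypothesis Om_r : forall x, closure Om x -> forall i, `|x 0 i - c 0 i| <= r.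
Hypothesis a0 : 0 < a.
Hypothesis cf : {within closure Om, continuous f}.
Hypothesis f_ge0 : forall x, closure Om x -> 0 <= f x.

Local Notation m := (n + n)%N.
Local Notation mu := (@lebesgue_rV R m).
Local Notation pln := (plane Om u c).
Local Notation env := (envelope Om u c a).
Local Notation sec := (section_at Om u c a).
Local Notation slp := (slopes_at Om u c a).
Local Notation ht := (height Om u c).

Let pln_le_env p y : slopes a p -> pln p y <= env y.
Proof. exact: plane_le_envelope. Qed.

Let env_le_u y : closure Om y -> env y <= u y.
Proof. exact: envelope_le_u. Qed.

Let cont_env : continuous env.
Proof. exact: continuous_envelope. Qed.

Definition contact : set 'rV[R]_m := [set x | closure Om x /\ u x <= env x].

Definition contact_nbhd (del : R) : set 'rV[R]_m :=
  [set x | exists2 y, contact y & `|x - y| < del].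

Lemma open_contact_nbhd del : open (contact_nbhd del).
Proof.
rewrite openE => x [y Ky xy]; apply/nbhs_ballP.
exists (del - `|x - y|) => /=; first by rewrite subr_gt0.
move=> z; rewrite -ball_normE /= => xz; exists y => //.
rewrite (le_lt_trans (ler_distD x _ _))// distrC.
by rewrite -ltrBrDr.
Qed.

Lemma continuous_measurable_on (g : 'rV[R]_m -> R) :
  {within closure Om, continuous g} -> measurable_fun setT (g \_ Om).
Proof.
move=> cg.
have cgO x : Om x -> {for x, continuous g} by move=> Ox; exact: (continuous_at_open oOm cg).
apply/(measurable_restrictT _ (open_measurable_rV oOm)).
apply: (measurability _ (RGenOpens.measurableE R)).
move=> _ [_ [p [q ->] <-]]; apply: open_measurable_rV.
rewrite openE => x [Ox gx]; apply: filterI; first exact: open_nbhs_nbhs.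
by apply: (cgO x Ox); apply: open_nbhs_nbhs; split=> //; exact: interval_open.
Qed.

Let f0 := f \_ Om.

Let f0E x : Om x -> f0 x = f x.
Proof. by move=> Ox; rewrite /f0 /patch mem_set. Qed.

Lemma f0_ge0 x : 0 <= f0 x.
Proof.
by rewrite /f0 /patch; case: ifPn => // /set_mem/subset_closure; exact: f_ge0.
Qed.

Lemma plane_diff_le p q y : closure Om y ->
  pln p y - pln q y <= 2 * (m%:R * r * `|p - q|).
Proof.
move=> Oy; have h1 := height_lipschitz Om0 cOm cu Om_r p q.
have : `|dotp (p - q) (y - c)| <= m%:R * (`|p - q| * r).
  apply: dotp_le => i; first exact: coord_le_norm.
  by have := Om_r Oy i; rewrite !mxE.
move=> /(le_trans (ler_norm _)); rewrite dotpBl /plane.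
rewrite (_ : m%:R * (`|p - q| * r) = m%:R * r * `|p - q|); last by ring.
move: h1; move: (m%:R * r * _) (ht p) (ht q) (dotp p _) (dotp q _) => *; lra.
Qed.

Section parameters.
Context (del eps rho h s sg A Fm : R).
Hypothesis del0 : 0 < del.
Hypothesis eps0 : 0 <= eps.
Hypothesis rho0 : 0 < rho.
Hypothesis h0 : 0 < h.
Hypothesis s0 : 0 < s.
Hypothesis sg0 : 0 < sg.
Hypothesis neg : forall p y, slopes a p -> closure Om y -> pln p y + 2 * h < 0.

(** If y is within 2h of the plane of slope q and |p - q| < rho, then y lies in the section of slope
    p at this larger height, by [plane_diff_le]. *)
Let h' : R := 2 * h + 2 * (m%:R * r * rho).

Hypothesis h'_le : 2 * h' <= s * (del / 4).
Hypothesis h_le : 2 * h <= sg * (rho / 4).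
Hypothesis s_le : s <= a / 2.
Hypothesis NOm : contact_nbhd del `<=` Om.
Hypothesis osc : forall x y, Om x -> Om y -> `|x - y| < del -> f y <= f x + eps.
Hypothesis OmA : Om `<=` cube A.
Hypothesis f_le : forall x, Om x -> f x <= Fm.

(** The cube has half the size of [slopes], so that p + s e_k and p - s e_k stay admissible; its
    measure is a^m. *)
Let P1 := cube (a / 2) `\` bad_slopes Om u c (a / 2) (del / 2) s.
Let X2 := bad_points Om u c a A (rho / 2) sg.

Let h'h : h <= h'.
Proof.
have : 0 <= m%:R * r * rho by rewrite mulr_ge0// ?mulr_ge0// ltW.
by rewrite /h'; move: h0 => ?; lra.
Qed.

Lemma P1_slopes p : P1 p -> slopes a p.
Proof.
move=> [Qp _] i; have := Qp i; rewrite /= in_itv/= => /andP[h1 h2].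
by rewrite ltr_norml; apply/andP; split; move: a0 => ?; lra.
Qed.

Lemma P1_shift p t k : P1 p -> `|t| <= s -> slopes a (p + t *: delta_mx 0 k).
Proof.
move=> [Qp _] ts i; have := Qp i; rewrite /= in_itv/= => /andP[h1 h2].
rewrite !mxE eqxx/=; move: ts; rewrite ler_norml => /andP[h3 h4].
case: (i == k); rewrite ?mulr1 ?mulr0 ?addr0 ltr_norml; apply/andP;
  by split; move: a0 s_le => ? ?; lra.
Qed.

(** For a good slope the second difference contributes less than s del / 2 and the height at most s
    del / 4, so each coordinate varies by at most 3 del / 4. *)
Lemma section_diam p x x' : P1 p -> sec h' p x -> sec h' p x' -> `|x - x'| < del.
Proof.
move=> P1p px px'; have d3 : 0 <= 3 * del / 4 by move: del0 => ?; lra.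
apply: (@le_lt_trans _ _ (3 * del / 4)); last by move: del0 => ?; lra.
apply: norm_le_coord => // k; rewrite !mxE.
have key y y' : sec h' p y -> sec h' p y' -> y 0 k - y' 0 k <= 3 * del / 4.
  move=> py py'.
  have p1 : slopes a (p + s *: delta_mx 0 k) by apply: P1_shift; rewrite // gtr0_norm.
  have p2 : slopes a (p - s *: delta_mx 0 k).
    by rewrite -scaleNr; apply: P1_shift; rewrite // normrN gtr0_norm.
  have D := coord_diff_section Om0 cOm cu a0 p1 p2 py py'.
  have nbad : second_difference (fun q => - ht q) s k p < del / 2 * s.
    rewrite ltNge; apply/negP => bad; case: P1p => Qp; apply.
    by rewrite /bad_slopes -bigcup_seq; exists k => //=; rewrite mem_index_enum.
  rewrite -(ler_pM2l s0); move: D nbad h'_le.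
  by move: (s * (y 0 k - _)) (second_difference _ _ _ _) h' => B C H; lra.
by rewrite ler_norml; apply/andP; split; have := key x x' px px'; have := key x' x px' px; lra.
Qed.

Lemma slopes_diam x p q : cube A x -> ~ X2 x -> slp h x p -> slp h x q ->
  `|p - q| < rho.
Proof.
move=> Ax nX2 xp xq; have d3 : 0 <= 3 * rho / 4 by move: rho0 => ?; lra.
apply: (@le_lt_trans _ _ (3 * rho / 4)); last by move: rho0 => ?; lra.
apply: norm_le_coord => // k; rewrite !mxE.
have key y y' : slp h x y -> slp h x y' -> y 0 k - y' 0 k <= 3 * rho / 4.
  move=> py py'.
  have D := coord_diff_slopes Om0 cOm cu a0 sg k py py'.
  have nbad : second_difference env sg k x < rho / 2 * sg.
    rewrite ltNge; apply/negP => bad; apply: nX2.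
    by rewrite /X2 /bad_points -bigcup_seq; exists k => //=; rewrite mem_index_enum.
  rewrite -(ler_pM2l sg0); move: D nbad h_le.
  by move: (sg * (y 0 k - _)) (second_difference _ _ _ _) => B C; lra.
by rewrite ler_norml; apply/andP; split; have := key p q xp xq; have := key q p xq xp; lra.
Qed.

Lemma sec_sub h1 h2 p : h1 <= h2 -> sec h1 p `<=` sec h2 p.
Proof. by move=> h12 x; rewrite /section_at/= => /lt_le_trans; apply; rewrite lerD2l. Qed.

Lemma section_contact p : P1 p -> exists2 y, contact y & sec h p y.
Proof.
move=> P1p; have [y Oy uy] := height_attained c Om0 cOm cu p.
exists y; first by split=> //; rewrite uy pln_le_env//; exact: P1_slopes.
by rewrite /section_at/= -uy (le_lt_trans (env_le_u Oy))// ltrDl.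
Qed.

Lemma section_sub_nbhd p : P1 p -> sec h p `<=` contact_nbhd del.
Proof.
move=> P1p x px; have [y Ky py] := section_contact P1p; exists y => //.
by apply: (section_diam P1p); exact: sec_sub h'h _ _.
Qed.

(* Every contact point whose slope lies in [slp h x] is close to [x] unless [x]
   is a bad point, since the slopes of [slp h x] are then close to each other. *)
Lemma slopes_at_le x p : contact_nbhd del x -> P1 p -> slp h x p ->
  (mu (slp h x) <=
   (slopes_const R n * h ^+ n * (f0 x + eps + Fm * \1_X2 x))%:E)%E.
Proof.
move=> Nx P1p xp; have Ox := NOm Nx.
have c0 : 0 <= slopes_const R n * h ^+ n.
  by rewrite mulr_ge0 ?slopes_const_ge0// exprn_ge0// ltW.
have [|q [y [xq Oy uy /le_trans]]] := slopes_at_measure n0 oOm Om0 cOm cu visc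
  u_ge0 Om_r a0 (x := x) h0 _ neg.
  by exists p.
apply; rewrite lee_fin ler_wpM2l// f0E// indicE.
have [xX2|xX2] := boolP (x \in X2).
  by rewrite mulr1 (le_trans (f_le Oy))// lerDr addr_ge0// f_ge0//; exact: subset_closure.
rewrite mulr0 addr0; apply: osc => //.
have pq : `|q - p| < rho.
  by apply: (slopes_diam (OmA Ox)) => //; move: xX2; rewrite notin_setE.
apply: (section_diam P1p); first by apply: (sec_sub h'h); exact: xp.2.
rewrite /section_at/=.
have Oy' := subset_closure Oy.
have := plane_diff_le q p Oy'; have := env_le_u Oy'.
have : m%:R * r * `|q - p| <= m%:R * r * rho.
  by rewrite ler_wpM2l// ?mulr_ge0// ltW.
move: uy; rewrite /h'.
move: (m%:R * r * _) (m%:R * r * rho) (u y) (env y) (pln q y) (pln p y) => *; lra.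
Qed.

(* The set W_h of the header, restricted to good slopes. *)
Let W : set ('rV[R]_m * 'rV[R]_m) :=
  [set z | [/\ P1 z.1, contact_nbhd del z.2 & env z.2 < pln z.1 z.2 + h]].

Let mP1 : measurable P1.
Proof.
apply: measurableD; first exact: measurable_cube.
exact: (measurable_bad_slopes Om0 cOm cu Om_r).
Qed.

Let mN : measurable (contact_nbhd del).
Proof. by apply: open_measurable_rV; exact: open_contact_nbhd. Qed.

Let measurable_plane :
  measurable_fun setT (fun z : 'rV[R]_m * 'rV[R]_m => pln z.1 z.2).
Proof.
have cht : continuous ht by exact: (continuous_height Om0 cOm cu Om_r).
have mht : measurable_fun setT ht by exact: (continuous_measurable_rV cht).
apply: measurable_funD; first exact: (measurableT_comp mht measurable_fst).
apply: measurable_sum => i; apply: measurable_funM.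
  exact: (measurableT_comp (measurable_coord_rV i) measurable_fst).
rewrite (_ : (fun _ => _) = (fun z => (z.2 : 'rV[R]_m) 0 i - c 0 i)).
  apply: measurable_funB => //.
  exact: (measurableT_comp (measurable_coord_rV i) measurable_snd).
by apply/funext => z; rewrite !mxE.
Qed.

Let mW : measurable W.
Proof.
rewrite (_ : W = (P1 `*` contact_nbhd del) `&`
    [set z | env z.2 < pln z.1 z.2 + h]); last first.
  by apply/seteqP; split=> [z []|z [[]]].
apply: measurableI; first exact: measurableX.
rewrite -[X in measurable X]setTI.
rewrite (_ : [set z | _] = (fun z : 'rV[R]_m * 'rV[R]_m =>
    env z.2 < pln z.1 z.2 + h) @^-1` [set true]); last first.
  by apply/seteqP; split=> z /=.
apply: measurable_fun_ltr => //.
  exact: (measurableT_comp (continuous_measurable_rV cont_env) measurable_snd).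
exact: measurable_funD.
Qed.

Let int_indic B : measurable B -> mu B = (\int[mu]_x (\1_B x)%:E)%E.
Proof. by move=> mB; rewrite integral_indic// setIT. Qed.

Let EFin_indic B : measurable B -> measurable_fun setT (fun x : 'rV[R]_m => (\1_B x)%:E : \bar R).
Proof. by move=> mB; apply/measurable_EFinP; exact: measurable_indic. Qed.

Let mf0 : measurable_fun setT f0.
Proof. exact: continuous_measurable_on. Qed.

(** The two volume estimates involve f at a touching point; the term eps pays for replacing it by f
    at the point of integration. *)
Let k (z : 'rV[R]_m * 'rV[R]_m) : \bar R := (\1_W z * (f0 z.2 + eps))%:E.

Let k_ge0 z : (0 <= k z)%E.
Proof. by rewrite lee_fin mulr_ge0// addr_ge0// f0_ge0. Qed.

Let mk : measurable_fun setT k.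
Proof.
apply/measurable_EFinP; apply: measurable_funM; first exact: measurable_indic.
apply: measurable_funD => //.
exact: (measurableT_comp mf0 measurable_snd).
Qed.

(** The section of a good slope has diameter less than del, so it lies in the neighbourhood of the
    contact set, and f at the touching point is at most f x + eps for every x in it. *)
Let k_lower p : ((section_const R n * h ^+ n)%:E * (\1_P1 p)%:E <=
  \int[mu]_x k (p, x))%E.
Proof.
rewrite indicE; have [/set_mem P1p|] := boolP (p \in P1); last first.
  by rewrite mule0 => _; apply: integral_ge0.
rewrite mule1.
have neg' y : closure Om y -> pln p y + h < 0.
  by move=> Oy; have := neg (P1_slopes P1p) Oy; move: h0 => ?; lra.
have [y0 Ky0 py0] := section_contact P1p.
have SB x : sec h p x -> `|x| <= `|y0| + del.
  move=> px; rewrite -lerBlDl (le_trans (lerB_dist _ _))// ltW//.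
  by apply: (section_diam P1p); exact: sec_sub h'h _ _.
have [y [Oy py /le_trans]] := section_at_measure n0 oOm Om0 cOm cu visc u_ge0 a0 h0
  (P1_slopes P1p) SB neg'.
apply.
have msec : measurable (sec h p) by apply: open_measurable_rV; exact: open_section_at.
have fy0 : 0 <= f y by apply: f_ge0; exact: subset_closure.
rewrite (int_indic msec) -(@ge0_integralZl _ _ R mu _ measurableT _ (EFin_indic msec))//.
apply: ge0_le_integral => //.
- by move=> x _; rewrite mule_ge0// lee_fin.
- by apply: emeasurable_funM => //; exact: EFin_indic.
- apply: (measurableT_comp mk); exact: pair1_measurable.
move=> x _; rewrite /k -EFinM lee_fin !indicE.
have [/set_mem px|] := boolP (x \in sec h p); last first.
  by rewrite mulr0 => _; rewrite mulr_ge0// addr_ge0// f0_ge0.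
have Nx := section_sub_nbhd P1p px.
rewrite mem_set//= mulr1 mul1r f0E; last exact: NOm.
apply: osc => //; first exact: NOm.
by apply: (section_diam P1p); exact: sec_sub h'h _ _.
Qed.

(** One factor f is the weight in [k], the other comes from the measure of [slp h x]. At bad points
    the latter carries an extra Fm, harmless because [X2] will be small. *)
Let k_upper x : (\int[mu]_p k (p, x) <=
  (slopes_const R n * h ^+ n)%:E * ((\1_(contact_nbhd del) x * (f0 x + eps) ^+ 2)%:E +
    ((Fm + eps) * Fm)%:E * (\1_X2 x)%:E))%E.
Proof.
have c0 : 0 <= slopes_const R n * h ^+ n.
  by rewrite mulr_ge0 ?slopes_const_ge0// exprn_ge0// ltW.
have Fm0 : 0 <= Fm.
  by have [z Oz] := Om0; rewrite (le_trans (f_ge0 (subset_closure Oz)))// f_le.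
have R0 : (0 <= (slopes_const R n * h ^+ n)%:E *
    ((\1_(contact_nbhd del) x * (f0 x + eps) ^+ 2)%:E +
    ((Fm + eps) * Fm)%:E * (\1_X2 x)%:E))%E.
  rewrite -!(EFinM, EFinD) lee_fin mulr_ge0// addr_ge0//.
    by rewrite mulr_ge0// sqr_ge0.
  by rewrite !mulr_ge0// addr_ge0.
have [[p [Nx P1p xp]]|none] :=
    pselect (exists p, [/\ contact_nbhd del x, P1 p & slp h x p]); last first.
  rewrite integral0_eq// => p _; rewrite /k indicE memNset ?mul0r// => -[/= Wp Wx Wl].
  by apply: none; exists p; split=> //; split=> //; exact: P1_slopes.
have mslp : measurable (slp h x).
  apply: open_measurable_rV.
  by have := open_slopes_at (h := h) (x := x) Om0 cOm cu Om_r a0.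
have fx0 : 0 <= f0 x + eps by rewrite addr_ge0// f0_ge0.
apply: (@le_trans _ _ ((f0 x + eps)%:E * mu (slp h x))%E).
  rewrite (int_indic mslp) -(@ge0_integralZl _ _ R mu _ measurableT _ (EFin_indic mslp))//.
  apply: ge0_le_integral => //.
  - by apply: (measurableT_comp mk); exact: pair2_measurable.
  - by apply: emeasurable_funM => //; exact: EFin_indic.
  move=> q _; rewrite /k -EFinM lee_fin !indicE /= [leRHS]mulrC ler_wpM2r//.
  have [/set_mem[/= Wp Wx Wl]|//] := boolP ((q, x) \in W).
  by rewrite mem_set//; split=> //; exact: P1_slopes.
apply: (@le_trans _ _ ((f0 x + eps)%:E * (slopes_const R n * h ^+ n *
    (f0 x + eps + Fm * \1_X2 x))%:E)%E).
  by apply: lee_wpmul2l => //; exact: slopes_at_le P1p xp.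
rewrite -!(EFinM, EFinD) lee_fin mulrCA ler_wpM2l// mulrDr (indicE _ (contact_nbhd del)).
rewrite (mem_set Nx) mul1r -expr2.
rewrite lerD2l mulrA ler_wpM2r// ler_wpM2r// lerD2r f0E; last exact: NOm.
by apply/f_le/NOm.
Qed.

(** The powers h ^+ n of the lower and upper bounds cancel, so h enters only through the constraints
    on the parameters. *)
Lemma tonelli_estimate :
  ((section_const R n)%:E * mu P1 <= (slopes_const R n)%:E *
    (\int[mu]_x (\1_(contact_nbhd del) x * (f0 x + eps) ^+ 2)%:E +
     ((Fm + eps) * Fm)%:E * mu X2))%E.
Proof.
have c0 : 0 <= slopes_const R n * h ^+ n.
  by rewrite mulr_ge0 ?slopes_const_ge0// exprn_ge0// ltW.
have c40 : 0 <= section_const R n * h ^+ n.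
  by rewrite mulr_ge0// ?exprn_ge0// ltW// section_const_gt0.
have Fm0 : 0 <= Fm.
  by have [z Oz] := Om0; rewrite (le_trans (f_ge0 (subset_closure Oz)))// f_le.
have mX2 : measurable X2 by exact: (measurable_bad_points c Om0 cOm cu a0).
have hn : 0 < h ^+ n by rewrite exprn_gt0.
have hnE : (0 < (h ^+ n)%:E)%E by rewrite lte_fin.
rewrite -(@lee_pmul2l _ (h ^+ n)%:E)// !muleA -!EFinM ![h ^+ n * _]mulrC.
rewrite (int_indic mP1) (int_indic mX2).
have i1 : measurable_fun setT (fun p => (\1_P1 p)%:E : \bar R).
  exact: (EFin_indic mP1).
have i2 : measurable_fun setT (fun p => (\1_X2 p)%:E : \bar R).
  exact: (EFin_indic mX2).
have i3 : measurable_fun setT (fun x => (\1_(contact_nbhd del) x * (f0 x + eps) ^+ 2)%:E : \bar R).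
  apply/measurable_EFinP; apply: measurable_funM; first exact: measurable_indic.
  by apply: measurable_funX; exact: measurable_funD.
have FF : 0 <= (Fm + eps) * Fm by rewrite mulr_ge0// addr_ge0.
rewrite -(@ge0_integralZl _ _ R mu _ measurableT _ i1)//.
rewrite -(@ge0_integralZl _ _ R mu _ measurableT _ i2)//.
rewrite -ge0_integralD//; last 3 first.
  - by move=> x _; rewrite lee_fin mulr_ge0// sqr_ge0.
  - by move=> x _; rewrite mule_ge0// lee_fin.
  - exact: emeasurable_funM.
rewrite -ge0_integralZl//; last 2 first.
  - by apply: emeasurable_funD => //; exact: emeasurable_funM.
  - move=> x _; rewrite adde_ge0 ?mule_ge0 ?lee_fin//.
    by rewrite mulr_ge0// sqr_ge0.
apply: (@le_trans _ _ (\int[mu]_p \int[mu]_x k (p, x))%E).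
  apply: ge0_le_integral => //.
  - by move=> x _; rewrite mule_ge0// lee_fin.
  - exact: emeasurable_funM.
  exact: measurable_fun_fubini_tonelli_F.
rewrite fubini_tonelli//; apply: ge0_le_integral => //.
- by move=> x _; exact: integral_ge0.
- exact: measurable_fun_fubini_tonelli_G.
by apply: emeasurable_funM => //; apply: emeasurable_funD => //; exact: emeasurable_funM.
Qed.

End parameters.

End tonelli.

(** * Uniformity on compact sets *)

Section compactness.
Context {R : realType} {m : nat}.
Implicit Types (A K : set 'rV[R]_m) (g : 'rV[R]_m -> R) (x y z : 'rV[R]_m).

Lemma within_continuous_ball A g x e :
  {within A, continuous g} -> A x -> 0 < e ->
  exists2 d, 0 < d & forall y, A y -> `|x - y| < d -> `|g x - g y| < e.
Proof.
move=> cg Ax e0; have gx : \forall y \near nbhs (x : subspace A), `|g x - g y| < e.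
  by have /cvgrPdist_lt := cg x; apply.
have [V /nbhs_ballP[d /= d0 dV] UV] := (nbhs_subspace_ex _ Ax).1 gx.
exists d => // y Ay xy.
have : (V `&` A) y by split=> //; apply: dV; rewrite -ball_normE.
by rewrite -UV => -[].
Qed.

(** Compactness in its near-covering form, indexed by the filter of small positive d: a local e that
    works for all smaller d yields one d for the whole of K. *)
Lemma compact_uniform K (P : R -> 'rV[R]_m -> Prop) : compact K ->
  (forall x, K x -> exists2 e, 0 < e & forall d y, K y -> `|x - y| < e ->
     0 < d -> d < e -> P d y) ->
  exists2 d, 0 < d & forall y, K y -> P d y.
Proof.
move=> /compact_near_coveringP cK KP.
have F : \forall d \near 0^'+, K `<=` [set y | K y -> 0 < d -> P d y].
  apply: (cK R (0^'+) (fun d y => K y -> 0 < d -> P d y)) => x Kx.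
  have [e e0 eP] := KP x Kx.
  exists (ball x e, [set d | d < e]) => /=.
    by split; [exact: nbhsx_ballx|exact: nbhs_right_lt].
  move=> [y d] /= [xy de] Ky d0; apply: eP => //.
  by move: xy; rewrite -ball_normE.
have [d [Fd d0]] := filter_ex (filterI F (nbhs_right_gt 0)).
by exists d => // y Ky; exact: Fd.
Qed.

End compactness.

(** * Elimination of the parameters and passage to the contact set *)

Section limit.
Context {R : realType} {n : nat} (Om : set 'rV[R]_(n + n)).
Context (f u : 'rV[R]_(n + n) -> R) (c : 'rV[R]_(n + n)) (r a : R).
Hypothesis n0 : (0 < n)%N.
Hypothesis oOm : open Om.
Hypothesis Om0 : Om !=set0.
Hypothesis cOm : compact (closure Om).
Hypothesis cu : {within closure Om, continuous u}.
Hypothesis visc : viscosity_supersolution Om f u.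
Hypothesis u_ge0 : forall x, boundary Om x -> 0 <= u x.
Hypothesis r0 : 0 < r.
Hypothesis Om_r : forall x, closure Om x -> forall i, `|x 0 i - c 0 i| <= r.
Hypothesis a0 : 0 < a.
Hypothesis cf : {within closure Om, continuous f}.
Hypothesis f_ge0 : forall x, closure Om x -> 0 <= f x.

Local Notation m := (n + n)%N.
Local Notation mu := (@lebesgue_rV R m).
Local Notation pln := (plane Om u c).
Local Notation env := (envelope Om u c a).

Context (A Fm eta : R).
Hypothesis eta0 : 0 < eta.
Hypothesis neg : forall p y, slopes a p -> closure Om y -> pln p y + eta < 0.
Hypothesis A0 : 0 <= A.
Hypothesis OmA : Om `<=` cube A.
Hypothesis f_le : forall x, Om x -> f x <= Fm.

Local Notation f0 := (f \_ Om).
Local Notation N := (contact_nbhd Om u c a).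

Let Fm0 : 0 <= Fm.
Proof. by have [z Oz] := Om0; rewrite (le_trans (f_ge0 (subset_closure Oz)))// f_le. Qed.

Let slopes_const0 : 0 <= slopes_const R n.
Proof. exact: slopes_const_ge0. Qed.

Let good_slopes_measure del s :
  (mu (bad_slopes Om u c (a / 2) del s) <= (a ^+ m / 2)%:E)%E ->
  ((a ^+ m / 2)%:E <= mu (cube (a / 2) `\` bad_slopes Om u c (a / 2) del s))%E.
Proof.
set B := bad_slopes _ _ _ _ _ _ => muB.
have mB : measurable B by exact: (measurable_bad_slopes Om0 cOm cu Om_r).
have mQ : measurable (cube (a / 2) `\` B : set 'rV[R]_m).
  by apply: measurableD => //; exact: measurable_cube.
have : (mu (cube (a / 2)) <= mu (cube (a / 2) `\` B) + mu B)%E.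
  apply: le_trans (measureU2 _ mQ mB); rewrite le_measure ?inE//.
  - exact: measurable_cube.
  - exact: measurableU.
  - by move=> x Qx; have [Bx|Bx] := pselect (B x); [right|left].
rewrite lebesgue_rV_cube ?divr_ge0 ?(ltW a0)// mulrCA divff// mulr1 => h.
have := le_trans h (leeD2l _ muB).
by rewrite -leeBlDr// -EFinB; congr (_ <= _)%E; congr EFin; field.
Qed.

(** The parameters are fixed in the order s, rho, sg, h: s keeps at least half of the slopes good,
    rho makes the error in the slope small against s del, sg makes the bad points contribute at most
    tau, and h meets the remaining constraints. As tau is arbitrary, no trace of them is left. *)
Lemma tonelli_limit del eps : 0 < del -> 0 <= eps -> N del `<=` Om ->
  (forall x y, Om x -> Om y -> `|x - y| < del -> f y <= f x + eps) ->
  ((section_const R n * (a ^+ m / 2))%:E <= (slopes_const R n)%:E *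
    \int[mu]_x (\1_(N del) x * (f0 x + eps) ^+ 2)%:E)%E.
Proof.
move=> del0 eps0 NOm osc; apply/lee_addgt0Pr => tau tau0.
have am0 : 0 < a ^+ m by rewrite exprn_gt0.
(* The bound of [bad_slopes_measure] for the cube of half-side a / 2 and threshold del / 2, without
   its factor s. *)
pose Kc := m%:R * (2 * (m%:R * r) / (del / 2) * a ^+ m.-1).
have Kc0 : 0 <= Kc.
  by rewrite !mulr_ge0 ?exprn_ge0 ?invr_ge0 ?divr_ge0 ?(ltW r0) ?(ltW a0) ?(ltW del0).
pose s := Num.min (a / 2) (a ^+ m / 2 / (Kc + 1)).
have s0 : 0 < s by rewrite lt_min !divr_gt0// ltr_wpDl.
have s_le : s <= a / 2 by rewrite ge_min lexx.
have sK : s * Kc <= a ^+ m / 2.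
  rewrite (@le_trans _ _ (s * (Kc + 1)))// ?ler_wpM2l ?(ltW s0) ?lerDl//.
  by rewrite -ler_pdivlMr ?ltr_wpDl// ge_min lexx orbT.
(* The bound s del / 4 on 2 h' is split in two: 4 m r rho <= s del / 8 here, and 4 h <= s del / 8 by
   the choice of h. *)
pose rho := s * del / (32 * (m%:R * r + 1)).
have mr : 0 <= m%:R * r by rewrite mulr_ge0// ltW.
have rho0 : 0 < rho by rewrite divr_gt0 ?mulr_gt0// ltr_wpDl.
have rhoE : 32 * (m%:R * r * rho) <= s * del.
  rewrite (@le_trans _ _ (32 * ((m%:R * r + 1) * rho)))//.
    by rewrite ler_pM2l// ler_wpM2r ?lerDl// ltW.
  by rewrite /rho mulrA mulrC divfK// gt_eqF// mulr_gt0// ltr_wpDl.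
(* The contribution of the bad points without its factor sg, so that sg can be chosen from it. *)
pose L := slopes_const R n * ((Fm + eps) * Fm) *
  (m%:R * (2 * (m%:R * a) / (rho / 2) * (2 * A) ^+ m.-1)).
have L0 : 0 <= L.
  apply: mulr_ge0; first by rewrite !mulr_ge0// addr_ge0.
  apply: mulr_ge0 => //; apply: mulr_ge0; last by rewrite exprn_ge0// mulr_ge0.
  apply: divr_ge0; last by rewrite divr_ge0// ltW.
  by rewrite !mulr_ge0// ltW.
pose sg := tau / (L + 1).
have sg0 : 0 < sg by rewrite divr_gt0// ltr_wpDl.
have sgL : sg * L <= tau.
  rewrite (@le_trans _ _ (sg * (L + 1)))// ?ler_wpM2l ?(ltW sg0) ?lerDl//.
  by rewrite divfK// gt_eqF// ltr_wpDl.
pose h := Num.min (s * del / 32) (Num.min (sg * rho / 8) (eta / 2)).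
have h0 : 0 < h by rewrite !lt_min !divr_gt0// mulr_gt0.
have h1 : h <= s * del / 32 by rewrite ge_min lexx.
have h2 : h <= sg * rho / 8 by rewrite !ge_min lexx orbT.
have h3 : h <= eta / 2 by rewrite !ge_min lexx !orbT.
have neg' p y : slopes a p -> closure Om y -> pln p y + 2 * h < 0.
  by move=> pa Oy; have := neg pa Oy; lra.
have h'_le : 2 * (2 * h + 2 * (m%:R * r * rho)) <= s * (del / 4).
  by move: h1 rhoE; rewrite !mulrA; move: (s * del) => *; lra.
have h_le : 2 * h <= sg * (rho / 4).
  by move: h2; rewrite !mulrA; move: (sg * rho) => *; lra.
have T := tonelli_estimate n0 oOm Om0 cOm cu visc u_ge0 r0 Om_r a0 cf f_ge0
  del0 eps0 rho0 h0 s0 sg0 neg' h'_le h_le s_le NOm osc OmA f_le.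
have P1 := @good_slopes_measure (del / 2) s.
have B1 := @bad_slopes_measure _ _ Om u c r Om0 cOm cu Om_r (a / 2) (del / 2) s.
have B2 := @bad_points_measure _ _ Om u c a Om0 cOm cu a0 A (rho / 2) sg A0 sg0.
have {B2} B2 := B2 (divr_gt0 rho0 (ltr0Sn _ 1)).
apply: le_trans (le_trans T _).
  rewrite EFinM; apply: lee_wpmul2l.
    by rewrite lee_fin ltW// section_const_gt0.
  apply: P1; apply: (le_trans (B1 _ _ _)); rewrite ?divr_gt0 ?divr_ge0 ?(ltW a0)//.
  rewrite lee_fin (le_trans _ sK)// /Kc [2 * (a / 2)]mulrCA divff// mulr1.
  by rewrite le_eqVlt; apply/orP; left; apply/eqP; ring.
rewrite ge0_muleDr; last 2 first.
- by apply: integral_ge0 => x _; rewrite lee_fin mulr_ge0// sqr_ge0.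
- by rewrite mule_ge0// lee_fin mulr_ge0// addr_ge0.
apply: leeD => //; rewrite muleA -EFinM.
have CF : 0 <= slopes_const R n * ((Fm + eps) * Fm) by rewrite !mulr_ge0// addr_ge0.
apply: (le_trans (lee_wpmul2l _ B2)); first by rewrite lee_fin.
rewrite -EFinM lee_fin (le_trans _ sgL)// /L.
by rewrite le_eqVlt; apply/orP; left; apply/eqP; ring.
Qed.

Lemma contact_Om : contact Om u c a `<=` Om.
Proof.
move=> x [cx ux]; apply: contrapT => nx.
have : 0 <= u x by apply: u_ge0; split=> // /interior_subset.
apply/negP; rewrite -ltNge (le_lt_trans ux)//.
apply: (@le_lt_trans _ _ (- eta)); last by rewrite oppr_lt0.
apply: envelope_le => // p pa; have := neg pa cx; lra.
Qed.

(** Around a contact point Om contains a ball; around any other point of the closure u - env stays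
    positive, so there is no contact point nearby. *)
Lemma contact_nbhd_small : exists2 del, 0 < del & N del `<=` Om.
Proof.
have [|d d0 dP] := @compact_uniform _ _ _ (fun d y => contact Om u c a y ->
    forall z, `|z - y| < d -> Om z) cOm; last first.
  by exists d => // x [y Ky xy]; apply: (dP y) => //; case: Ky.
move=> x cx; have [Kx|nKx] := pselect (contact Om u c a x).
  have : nbhs x Om by apply: open_nbhs_nbhs; split => //; exact: contact_Om.
  move=> /nbhs_ballP[e /= e0 eO]; exists (e / 2); first by rewrite divr_gt0.
  move=> d y cy xy d0 de _ z zy; apply: eO; rewrite -ball_normE /=.
  by have := ler_distD y x z; rewrite [`|y - z|]distrC; lra.
have ux : 0 < u x - env x.
  by rewrite subr_gt0 ltNge; apply/negP => h; apply: nKx.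
have cue : {within closure Om, continuous (fun y => u y - env y)}.
  move=> y; apply: (continuousB (cu (x := y))).
  exact: (continuous_subspaceT (continuous_envelope (c := c) Om0 cOm cu a0) (x := y)).
have [e e0 eP] := within_continuous_ball cue cx ux.
exists e => // d y cy xy _ _ [_ uy]; have := eP y cy xy.
by rewrite ltr_distlC => /andP[]; lra.
Qed.

Lemma oscillation_small eps : 0 < eps -> exists2 del, 0 < del &
  forall x y, Om x -> Om y -> `|x - y| < del -> f y <= f x + eps.
Proof.
move=> eps0; have [|d d0 dP] := @compact_uniform _ _ _ (fun d x => forall y,
    closure Om y -> `|x - y| < d -> f y <= f x + eps) cOm; last first.
  by exists d => // x y Ox Oy; apply: dP; exact: subset_closure.
move=> x cx; have [e e0 eP] := within_continuous_ball cf cx (divr_gt0 eps0 (ltr0Sn _ 1)).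
exists (e / 2); first by rewrite divr_gt0.
move=> d y cy xy d0 de z cz yz.
have xz : `|x - z| < e by have := ler_distD y x z; lra.
have xy' : `|x - y| < e by lra.
have := eP z cz xz; have := eP y cy xy'.
by rewrite !ltr_distlC => /andP[? ?] /andP[? ?]; lra.
Qed.

Lemma contact_nbhdS d d' : d <= d' -> N d `<=` N d'.
Proof. by move=> dd x [y Ky xy]; exists y => //; exact: lt_le_trans dd. Qed.

Let measurable_N d : measurable (N d).
Proof. by apply: open_measurable_rV; exact: open_contact_nbhd. Qed.

(** One parameter now governs both the neighbourhood and the error, so the limit can be taken along
    a single sequence. *)
Lemma contact_nbhd_bound eps : 0 < eps ->
  ((section_const R n * (a ^+ m / 2))%:E <= (slopes_const R n)%:E *
    \int[mu]_x (\1_(N eps) x * (f0 x + eps) ^+ 2)%:E)%E.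
Proof.
move=> eps0; have [d1 d10 d1P] := contact_nbhd_small.
have [d2 d20 d2P] := oscillation_small eps0.
pose d := Num.min eps (Num.min d1 d2).
have d0 : 0 < d by rewrite !lt_min eps0 d10.
have de : d <= eps by rewrite ge_min lexx.
have dd1 : d <= d1 by rewrite !ge_min lexx orbT.
have dd2 : d <= d2 by rewrite !ge_min lexx !orbT.
have Nd : N d `<=` Om by exact: (subset_trans (contact_nbhdS dd1)).
have osc x y : Om x -> Om y -> `|x - y| < d -> f y <= f x + eps.
  by move=> Ox Oy /lt_le_trans/(_ dd2); exact: d2P.
apply: (le_trans (tonelli_limit d0 (ltW eps0) Nd osc)).
apply: lee_wpmul2l; first by rewrite lee_fin.
have mg e : measurable_fun setT (fun x => (\1_(N e) x * (f0 x + eps) ^+ 2)%:E : \bar R).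
  apply/measurable_EFinP; apply: measurable_funM; first exact: measurable_indic.
  apply: measurable_funX; apply: measurable_funD => //.
  exact: (continuous_measurable_on oOm cf).
apply: ge0_le_integral => //.
- by move=> x _; rewrite lee_fin mulr_ge0// sqr_ge0.
move=> x _; rewrite lee_fin ler_wpM2r ?sqr_ge0// !indicE ler_nat.
by case: (boolP (x \in N d)) => // /set_mem/(contact_nbhdS de)/mem_set->.
Qed.

(* The contact set, which is closed, in a visibly measurable form. *)
Definition contact_core : set 'rV[R]_m := \bigcap_k N (harmonic k).

Lemma contact_core_subset : contact_core `<=` [set x | Om x /\ contact Om u c a x].
Proof.
move=> x Kx.
have Ox : Om x.
  have [d d0 dO] := contact_nbhd_small; apply: dO.
  have /cvgr0Pnorm_lt/(_ d d0)[k _ /(_ k (leqnn k)) kd] := @cvg_harmonic R.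
  apply: contact_nbhdS (Kx k I).
  by apply: ltW; move: kd; rewrite ger0_norm// harmonic_ge0.
split => //; split; first exact: subset_closure.
rewrite leNgt; apply/negP => ux.
have cx : {for x, continuous (fun y => u y - env y)}.
  apply: continuousB; first exact: (continuous_at_open oOm cu).
  exact: (continuous_envelope Om0 cOm cu a0).
have : \forall y \near x, 0 < u y - env y.
  apply: (cvgr_gt _ cx); by rewrite subr_gt0.
move=> /nbhs_ballP[e /= e0 eP].
have /cvgr0Pnorm_lt/(_ e e0)[k _ /(_ k (leqnn k)) ke] := @cvg_harmonic R.
have [y [cy uy] xy] := Kx k I.
have /eP : ball x e y.
  rewrite -ball_normE /= (lt_trans xy)//.
  by move: ke; rewrite ger0_norm// harmonic_ge0.
by rewrite subr_gt0 ltNge uy.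
Qed.

Lemma contact_core_bound :
  ((section_const R n * (a ^+ m / 2))%:E <= (slopes_const R n)%:E *
    \int[mu]_x (\1_contact_core x * f0 x ^+ 2)%:E)%E.
Proof.
pose g k (x : 'rV[R]_m) : \bar R := (\1_(N (harmonic k)) x * (f0 x + harmonic k) ^+ 2)%:E.
have mK : measurable contact_core by exact: bigcapT_measurable.
have mf0 : measurable_fun setT f0 by exact: (continuous_measurable_on oOm cf).
(* The dominating function: as [harmonic k <= 1], the neighbourhoods stay within distance 1 of Om
   and f0 + harmonic k <= Fm + 1. *)
pose G (x : 'rV[R]_m) : \bar R := ((Fm + 1) ^+ 2 * \1_(cube (A + 1)) x)%:E.
have f0_le x : 0 <= f0 x <= Fm.
  rewrite /patch; case: ifPn => [/set_mem Ox|_]; last by rewrite lexx.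
  by rewrite f_le// andbT f_ge0//; exact: subset_closure.
have N_cube k : N (harmonic k) `<=` cube (A + 1).
  move=> x [y Ky xy] i; have := OmA (contact_Om Ky) i; rewrite /= !in_itv/=.
  have : `|x 0 i - y 0 i| < 1.
    have := coord_le_norm (x - y) i; rewrite !mxE => h.
    rewrite (le_lt_trans h)// (lt_le_trans xy)//= invf_le1// ler1n//.
  by rewrite ltr_norml => /andP[? ?] /andP[? ?]; apply/andP; split; lra.
have [] := @dominated_convergence _ _ R mu setT measurableT g
  (fun x : 'rV[R]_m => (\1_contact_core x * f0 x ^+ 2)%:E) G.
- move=> k; apply/measurable_EFinP; apply: measurable_funM; first exact: measurable_indic.
  by apply: measurable_funX; exact: measurable_funD.
- apply/measurable_EFinP; apply: measurable_funM; first exact: measurable_indic.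
  exact: measurable_funX.
- apply: aeW => x _; apply: cvg_EFin; first exact: nearW.
  have [Kx|nKx] := pselect (contact_core x).
    rewrite indicE mem_set// mul1r.
    rewrite (_ : _ \o _ = fun k => (f0 x + harmonic k) ^+ 2); last first.
      apply/funext => k; rewrite /= indicE mem_set ?mul1r//; exact: Kx.
    rewrite -[X in X ^+ _]addr0 expr2; under eq_fun do rewrite expr2.
    by apply: cvgM; apply: cvgD;
      [exact: cvg_cst|exact: cvg_harmonic|exact: cvg_cst|exact: cvg_harmonic].
  rewrite indicE memNset// mul0r.
  have [k nk] : exists k, ~ N (harmonic k) x.
    by apply: contrapT => /forallNP h; apply: nKx => k _; apply: contrapT; exact: h.
  apply: cvg_near_cst; exists k => // j /= kj; rewrite indicE memNset ?mul0r// => Nj.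
  apply: nk; apply: contact_nbhdS Nj.
  by rewrite /= lef_pV2 ?posrE ?ltr0n// ler_nat.
- have mC : measurable (cube (A + 1) : set 'rV[R]_m) by exact: measurable_cube.
  apply/integrableP; split.
    have mi : measurable_fun setT (\1_(cube (A + 1)) : 'rV[R]_m -> R).
      exact: measurable_indic.
    by apply/measurable_EFinP; exact: measurable_funM.
  rewrite (eq_integral (fun x => ((Fm + 1) ^+ 2)%:E * (\1_(cube (A + 1)) x)%:E)%E); last first.
    by move=> x _; rewrite /G EFinM gee0_abs// -EFinM lee_fin mulr_ge0// sqr_ge0.
  rewrite ge0_integralZl//; last 2 first.
    - by apply/measurable_EFinP; exact: measurable_indic.
    - by rewrite lee_fin sqr_ge0.
  rewrite integral_indic// setIT [X in (_ * X)%E](_ : _ = ((2 * (A + 1)) ^+ m)%:E).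
    by rewrite -EFinM ltry.
  by apply: lebesgue_rV_cube; rewrite addr_ge0.
- apply: aeW => x k _; rewrite /g /G lee_fin ger0_norm; last by rewrite mulr_ge0// sqr_ge0.
  have /andP[f1 f2] := f0_le x.
  have k0 : 0 <= harmonic k :> R by exact: harmonic_ge0.
  have k1 : harmonic k <= 1 :> R by rewrite /= invf_le1// ler1n.
  rewrite mulrC ler_pM ?sqr_ge0//.
    by rewrite lerXn2r ?nnegrE ?addr_ge0// lerD.
  rewrite !indicE ler_nat.
  by case: (boolP (x \in N _)) => // /set_mem/N_cube/mem_set->.
move=> _ _ cvg.
have cvg' : ((slopes_const R n)%:E * \int[mu]_x g k x)%E @[k --> \oo] -->
    ((slopes_const R n)%:E * \int[mu]_x (\1_contact_core x * f0 x ^+ 2)%:E)%E.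
  by apply: cvgeZl.
rewrite -(cvg_lim _ cvg')//; apply: lime_ge; first by apply/cvg_ex; eexists; exact: cvg'.
by apply: nearW => k; apply: contact_nbhd_bound; rewrite /= invr_gt0.
Qed.

End limit.

Lemma coord_le_enorm (R : realType) m (x : 'rV[R]_m) i : `|x 0 i| <= enorm x.
Proof.
rewrite /enorm -sqrtr_sqr ler_sqrt ?sumr_ge0// => [|j _]; last exact: sqr_ge0.
by rewrite (bigD1 i)//= lerDl sumr_ge0// => j _; exact: sqr_ge0.
Qed.

(* Applied to a contact set not known to be measurable; the integral of a
   nonnegative function is a supremum over simple functions. *)
Lemma ge0_integral_mono d (T : measurableType d) (R : realType)
    (mu : {measure set T -> \bar R}) (g1 g2 : T -> \bar R) :
  (forall x, 0 <= g1 x)%E -> (forall x, g1 x <= g2 x)%E ->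
  (\int[mu]_x g1 x <= \int[mu]_x g2 x)%E.
Proof.
move=> g0 g12; rewrite !ge0_integralTE//; last by move=> x; exact: le_trans (g12 x).
apply: le_ereal_sup => _ [h hg <-]; exists h => // x.
exact: le_trans (hg x) (g12 x).
Qed.

(** * Comparison with the convex envelope and extraction of the root *)

Section conclusion.
Context {R : realType} {n : nat} (Om : set 'rV[R]_(n + n)).
Context (f u : 'rV[R]_(n + n) -> R) (c : 'rV[R]_(n + n)) (r : R).
Hypothesis n0 : (0 < n)%N.
Hypothesis r0 : 0 < r.
Hypothesis dOm : domain Om.
Hypothesis Om_ball : compactly_contained Om (eball c r).
Hypothesis cf : {within closure Om, continuous f}.
Hypothesis f_ge0 : forall x, closure Om x -> 0 <= f x.
Hypothesis cu : {within closure Om, continuous u}.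
Hypothesis visc : viscosity_supersolution Om f u.
Hypothesis u_ge0 : forall x, boundary Om x -> 0 <= u x.

Local Notation m := (n + n)%N.
Local Notation mu := (@lebesgue_rV R m).

Let oOm : open Om. Proof. by case: dOm. Qed.

Let Om0 : Om !=set0. Proof. by case: dOm. Qed.

Let cOm : compact (closure Om). Proof. by case: Om_ball. Qed.

Let Om_lt x i : closure Om x -> `|x 0 i - c 0 i| < r.
Proof.
move=> Ox; have [_ /(_ _ Ox)] := Om_ball; rewrite /eball/=; apply: le_lt_trans.
by have := coord_le_enorm (x - c) i; rewrite !mxE.
Qed.

Let Om_r x : closure Om x -> forall i, `|x 0 i - c 0 i| <= r.
Proof. by move=> Ox i; exact/ltW/Om_lt. Qed.

Let m0 : (0 < m)%N. Proof. by rewrite addn_gt0 n0. Qed.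

Let mR : 0 < m%:R :> R. Proof. by rewrite ltr0n. Qed.

Section below.
Context (x0 : 'rV[R]_m).
Hypothesis Ox0 : Om x0.
Hypothesis ux0 : u x0 < 0.

Let M := - u x0.

Let M0 : 0 < M. Proof. by rewrite oppr_gt0. Qed.

(** With m a r = M / 8 the linear part of an admissible plane is at most M / 8 in absolute value
    over the closure of Om and M / 4 over the ball of radius 2r. The height being at most -M + M /
    8, planes are negative on the large ball, and below -M / 2 on the closure of Om. *)
Let a := M / (8 * m%:R * r).

Let a0 : 0 < a. Proof. by rewrite divr_gt0// !mulr_gt0. Qed.

Let aE : m%:R * (a * r) = M / 8.
Proof. by move: mR; rewrite /a; move: (m%:R) => k k0; field; rewrite !gt_eqF. Qed.

Let height_le p : slopes a p -> height Om u c p <= - M + M / 8.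
Proof.
move=> pa; have := plane_le c Om0 cOm cu p (subset_closure Ox0).
rewrite /plane => h.
have : `|dotp p (x0 - c)| <= m%:R * (a * r).
  apply: dotp_le => i; first by rewrite ltW// pa.
  by have := Om_r (subset_closure Ox0) i; rewrite !mxE.
rewrite aE ler_norml => /andP[h1 _]; rewrite /M in h1 *; lra.
Qed.

Let plane_neg p y : slopes a p -> closure Om y -> plane Om u c p y + M / 2 < 0.
Proof.
move=> pa Oy; have h1 := height_le pa.
have : `|dotp p (y - c)| <= m%:R * (a * r).
  apply: dotp_le => i; first by rewrite ltW// pa.
  by have := Om_r Oy i; rewrite !mxE.
rewrite aE ler_norml /plane => /andP[_ h2]; move: M0 => ?; lra.
Qed.

Let envelope_le0 y : eball c (2 * r) y -> envelope Om u c a y <= 0.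
Proof.
move=> By; apply: (envelope_le a0) => p pa; have h1 := height_le pa.
have : `|dotp p (y - c)| <= m%:R * (a * (2 * r)).
  apply: dotp_le => i; first by rewrite ltW// pa.
  by apply: le_trans (coord_le_enorm _ _) _; exact: ltW.
rewrite (_ : m%:R * (a * (2 * r)) = 2 * (m%:R * (a * r))); last by ring.
rewrite aE ler_norml /plane => /andP[_ h2]; move: M0 => ?; lra.
Qed.

(** The envelope is itself a competitor in [convex_envelope]: it is convex, below u on the closure
    of Om, and nonpositive on the large ball. Every competitor is at most u at x, so where u = env
    the supremum equals u. *)
Lemma contact_sub_contact_set x : Om x -> contact Om u c a x ->
  contact_set Om c r u x.
Proof.
move=> Ox [cx ux]; split => //.
have Bx : eball c (2 * r) x.
  have [_ /(_ _ cx)] := Om_ball; rewrite /eball/= => /lt_trans; apply.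
  by rewrite ltr_pMl// ltr1n.
have env0 := envelope_le0 Bx.
have uE : u x = envelope Om u c a x.
  by apply/eqP; rewrite eq_le ux/=; exact: (envelope_le_u c Om0 cOm cu a0).
have ub v : (forall y, eball c (2 * r) y -> v y <= - neg_part_ext Om u y) -> v x <= u x.
  move=> /(_ _ Bx); rewrite /neg_part_ext mem_set// /neg_part opprK.
  by rewrite le_min => /andP[].
have env_adm : [set v : 'rV[R]_m -> R |
    @convex_function R 'rV[R]_m (eball c (2 * r)) v /\
    forall y, eball c (2 * r) y -> v y <= - neg_part_ext Om u y] (envelope Om u c a).
  split.
    move=> t y z _ _.
    apply: (envelope_convex c Om0 cOm cu a0) => //.
      by rewrite -[leRHS]/(1 - t%:num) subr_ge0.
    by rewrite -[X in _ + X]/(1 - t%:num) addrCA subrr addr0.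
  move=> y By; rewrite /neg_part_ext; case: ifPn => [/set_mem Oy|_].
    by rewrite /neg_part opprK le_min envelope_le0// andbT (envelope_le_u c Om0 cOm cu a0).
  by rewrite oppr0 envelope_le0.
apply/eqP; rewrite eq_le /convex_envelope; apply/andP; split.
  rewrite [leLHS]uE; apply: ub_le_sup; last by exists (envelope Om u c a).
  by exists (u x) => _ [v [_ /ub vx] <-].
apply: ge_sup; first by exists (envelope Om u c a x), (envelope Om u c a).
by move=> _ [v [_ /ub vx] <-].
Qed.

(** The measurable core of the contact points lies in the contact set, where both integrands equal
    f^2; elsewhere the right-hand integrand is nonnegative. *)
Lemma slopes_volume_le :
  ((section_const R n * (a ^+ m / 2))%:E <= (slopes_const R n)%:E *
    (L2norm Om (fun x => f x * \1_(contact_set Om c r u) x)%R `^ 2))%E.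
Proof.
have M20 : 0 < M / 2 by rewrite divr_gt0.
have [x1 _ f1] : exists2 x1, x1 \in closure Om & forall t, t \in closure Om -> f t <= f x1.
  apply: EVT_max_rV => //; by have [z Oz] := Om0; exists z; exact: subset_closure.
have f_le x : Om x -> f x <= f x1.
  by move=> Ox; apply: f1; rewrite mem_set//; exact: subset_closure.
have A0 : 0 <= `|c| + r by rewrite addr_ge0// ltW.
have OmA : Om `<=` cube (`|c| + r).
  move=> x Ox i; rewrite /= in_itv/= -ltr_norml.
  rewrite -(subrK (c 0 i) (x 0 i)) (le_lt_trans (ler_normD _ _))// addrC.
  by rewrite ler_ltD// ?coord_le_norm// Om_lt//; exact: subset_closure.
apply: (le_trans (contact_core_bound n0 oOm Om0 cOm cu visc u_ge0 r0 Om_r a0 cf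
  f_ge0 M20 plane_neg A0 OmA f_le)).
apply: lee_wpmul2l.
  by rewrite lee_fin slopes_const_ge0.
rewrite /L2norm poweR_Lnorm//; apply: ge0_integral_mono => x.
  by rewrite lee_fin mulr_ge0// sqr_ge0.
rewrite poweR_EFin lee_fin powR_mulrn// real_normK ?num_real//.
have [Kx|nKx] := pselect (contact_core Om u c a x); last first.
  by rewrite indicE memNset// mul0r sqr_ge0.
have [Ox cx] := contact_core_subset oOm Om0 cOm cu u_ge0 a0 M20 plane_neg Kx.
have := contact_sub_contact_set Ox cx => Cx.
by rewrite !indicE !mem_set// /patch mem_set// !mulr1 mul1r.
Qed.

(** At least 1, so that kappa <= (kappa ^+ n) ^+ 2 and no root of the constant has to be
    extracted. *)
Let kappa : R := Num.max 1 (2 * slopes_const R n / section_const R n).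

Lemma neg_value_le :
  (M%:E <= (8 * m%:R * kappa * r)%:E *
    (L2norm Om (fun x => f x * \1_(contact_set Om c r u) x)%R `^ n%:R^-1))%E.
Proof.
have C30 := slopes_const_ge0 R n.
have nR : 0 < n%:R :> R by rewrite ltr0n.
have C40 : 0 < section_const R n by exact: section_const_gt0.
have k1 : 1 <= kappa by rewrite le_max lexx.
have k0 : 0 < kappa by exact: lt_le_trans k1.
have K0 : 0 < 8 * m%:R * kappa * r by rewrite !mulr_gt0.
have := slopes_volume_le.
have L0 : (0 <= L2norm Om (fun x => (f x * \1_(contact_set Om c r u) x)%R))%E.
  exact: Lnorm_ge0.
(* If the norm is infinite then so is the right-hand side, its constant and the exponent 1 / n being
   positive. *)
move: L0; case: (L2norm _ _) => [l|_ _|//]; last first.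
  by rewrite poweRyr ?invr_eq0 ?gt_eqF// gt0_muley ?lte_fin// leey.
rewrite lee_fin !poweR_EFin -!EFinM !lee_fin => l0; rewrite powR_mulrn// => h.
have h' : (a ^+ n) ^+ 2 <= kappa * l ^+ 2.
  rewrite -exprM muln2 -addnn.
  apply: (@le_trans _ _ (2 * slopes_const R n / section_const R n * l ^+ 2)); last first.
    by rewrite ler_wpM2r ?sqr_ge0// le_max lexx orbT.
  rewrite mulrAC ler_pdivlMr//.
  have -> : a ^+ (n + n) * section_const R n =
      2 * (section_const R n * (a ^+ (n + n) / 2)) by field.
  by rewrite -[leRHS]mulrA ler_pM2l.
have a1 : 0 <= a by exact: ltW.
have k2 : 0 <= kappa by exact: ltW.
have ak : (a / kappa) ^+ n <= l.
  rewrite expr_div_n ler_pdivrMr ?exprn_gt0//.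
  rewrite -(@ler_pXn2r _ 2)// ?nnegrE ?exprn_ge0//; last by rewrite mulr_ge0// exprn_ge0.
  rewrite (le_trans h')// mulrC exprMn ler_wpM2l ?sqr_ge0//.
  by rewrite -exprM -[leLHS]expr1 ler_weXn2l// muln_gt0 n0.
have ak0 : 0 <= a / kappa by exact: divr_ge0.
have : a / kappa <= l `^ n%:R^-1.
  have i0 : 0 <= n%:R^-1 :> R by rewrite invr_ge0 ltW.
  have l1 : l \is Num.nneg by [].
  have l2 : (a / kappa) ^+ n \is Num.nneg by rewrite nnegrE exprn_ge0.
  have := ge0_ler_powR i0 l2 l1 ak.
  by rewrite -powR_mulrn// -powRrM divff ?gt_eqF// powRr1.
rewrite ler_pdivrMr// /a ler_pdivrMr ?mulr_gt0// => /le_trans; apply.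
by rewrite le_eqVlt; apply/orP; left; apply/eqP; ring.
Qed.

End below.

End conclusion.

Theorem theorem1p2 (R : realType) (n : nat) (hn : (0 < n)%N) :
  exists C : R,
  forall (c : 'rV[R]_(n + n)) (r : R) (Omega : set 'rV[R]_(n + n))
         (f u : 'rV[R]_(n + n) -> R),
    0 < r ->
    domain Omega ->
    compactly_contained Omega (eball c r) ->
    {within closure Omega, continuous f} ->
    (forall x, closure Omega x -> 0 <= f x) ->
    {within closure Omega, continuous u} ->
    viscosity_supersolution Omega f u ->
    (forall x, boundary Omega x -> 0 <= u x) ->
    (ereal_sup [set (neg_part u x)%:E | x in Omega] <=
     (C * r)%:E *
     poweR (L2norm Omega (fun x => f x * \1_(contact_set Omega c r u) x)%R)
           (n%:R^-1))%E.
Proof.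
(* The factor 8m undoes the choice of the slope bound, M = 8 m r a; the maximum is the constant
   bounding a by the norm to the power 1 / n. *)
exists (8 * (n + n)%:R *
  Num.max 1 (2 * slopes_const R n / section_const R n)).
move=> c r Om f u r0 dOm Om_ball cf f_ge0 cu visc u_ge0.
apply: ge_ereal_sup => _ [x Ox <-]; rewrite /neg_part.
have [u0|u0] := leP 0 (u x).
  rewrite oppr0 mule_ge0 ?poweR_ge0// lee_fin !mulr_ge0 ?(ltW r0)//.
  by rewrite le_max ler01.
exact: neg_value_le.
Qed.
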